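(* Let $D\subset\mathbb{C}^n$ be open and invariant with respect to complex conjugation, and let $f\in\mathcal{S}^1(\Omega_D)$. Suppose that $f\in\ker(\partial/\partial x_h^c)$ for some $h\in\{1,\dots,n\}$. Then $$\Delta_h f'_{s,h}=0$$ (on $\Omega_D\setminus\mathbb{R}_h$, the domain of $f'_{s,h}$).
   Context: $\mathbb{H}$ is the algebra of quaternions with basis $1,i,j,k$, $\mathbb{S}_{\mathbb{H}}=\{q\in\mathbb{H}: q^2=-1\}$. $n\ge1$; $\mathcal{P}(n)$ is the set of subsets of $\{1,\dots,n\}$. For $K=\{k_1<\dots<k_p\}\in\mathcal{P}(n)$ and quaternions $q_{k_1},\dots,q_{k_p}$, put $q_K=q_{k_1}\cdots q_{k_p}$ ($q_\emptyset=1$), and $[q_K,a]=q_K\,a$ for $a\in\mathbb{H}$. For $z\in\mathbb{C}^n$, $\overline{z}^h$ is $z$ with its $h$-th coordinate conjugated. $D\subset\mathbb{C}^n$ is invariant with respect to complex conjugation if $z\in D\iff\overline{z}^h\in D$ for every $h$. Its circularization is $\Omega_D=\{(\alpha_l+J_l\beta_l)_{l=1}^n: (\alpha_l+i\beta_l)_{l=1}^n\in D,\ J_1,\dots,J_n\in\mathbb{S}_{\mathbb{H}}\}\subset\mathbb{H}^n$. Let $\{e_K\}_{K\in\mathcal{P}(n)}$ be a basis of $\mathbb{R}^{2^n}$. A stem function is $F=\sum_{K}e_KF_K:D\to\mathbb{H}\otimes\mathbb{R}^{2^n}$, $F_K:D\to\mathbb{H}$, with $F_K(\overline{z}^h)=(-1)^{|K\cap\{h\}|}F_K(z)$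 for all $K,h,z$. $F$ induces the slice function $f=\mathcal{I}(F):\Omega_D\to\mathbb{H}$, $f(x)=\sum_K[J_K,F_K(z)]$ for $x=(\alpha_l+J_l\beta_l)_l$, $z=(\alpha_l+i\beta_l)_l\in D$. Each slice function is induced by a unique stem function. $\mathcal{S}^1(\Omega_D)$ is the set of slice functions induced by stem functions of class $\mathcal{C}^1$ on $D$. Let $\mathcal{J}_h$ be the linear map of $\mathbb{H}\otimes\mathbb{R}^{2^n}$ with $\mathcal{J}_h(e_Ka)=e_{K\cup\{h\}}a$ if $h\notin K$ and $\mathcal{J}_h(e_Ka)=-e_{K\setminus\{h\}}a$ if $h\in K$. For $f=\mathcal{I}(F)\in\mathcal{S}^1(\Omega_D)$ and $z_h=\alpha_h+i\beta_h$, $\frac{\partial f}{\partial x_h^c}=\mathcal{I}\big(\frac12\big(\frac{\partial F}{\partial\alpha_h}+\mathcal{J}_h\big(\frac{\partial F}{\partial\beta_h}\big)\big)\big)$. $\mathbb{R}_h$ denotes the set of points whose $h$-th coordinate is real. The spherical $x_h$-derivative of $f=\mathcal{I}(F)$ is the slice function $f'_{s,h}=\mathcal{I}(F'_h)$ on $\Omega_D\setminus\mathbb{R}_h$, where $F'_h(z)=\beta_h^{-1}\sum_{K\in\mathcal{P}(n),\,h\notin K}e_KF_{K\cup\{h\}}(z)$ for $z\in D\setminus\mathbb{R}_h$, $z_h=\alpha_h+i\beta_h$. $\Delta_h$ is the Laplacian in the four real components of $x_h\in\mathbb{H}\cong\mathbb{R}^4$. *)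

(* Defs.v *)
From HB Require Import structures.
From mathcomp Require Import all_boot all_order all_algebra.
From mathcomp Require Import boolp classical_sets reals.
From mathcomp Require Import topology normedtype derive.
From mathcomp Require Import complex ring.
Set Implicit Arguments.
Unset Strict Implicit.
Unset Printing Implicit Defensive.
Import Order.TTheory GRing.Theory Num.Theory numFieldNormedType.Exports.
Local Open Scope classical_set_scope.
Local Open Scope ring_scope.
Local Open Scope complex_scope.

(* The usual topology of C = R[i], induced by the complex modulus; with it
   'rV[R[i]]_n carries the topology of C^n. *)
HB.instance Definition _ (R : realType) := NormedModule.copy R[i] R[i]^o.

(* Quaternions are stored by their coordinates in the basis 1, i, j, k; the
   normed R-module structure is that of R^4 (max norm), the product is the
   Hamilton product. *)
Definition quat (R : realType) : Type := 'rV[R]_4.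
HB.instance Definition _ (R : realType) := NormedModule.copy (quat R) 'rV[R]_4.

Section Quaternions.
Variable R : realType.
Implicit Types a b c : quat R.

Definition qbase (l : 'I_4) : quat R := delta_mx 0 l.

Definition q0 : 'I_4 := Ordinal (isT : 0 < 4)%N.
Definition q1 : 'I_4 := Ordinal (isT : 1 < 4)%N.
Definition q2 : 'I_4 := Ordinal (isT : 2 < 4)%N.
Definition q3 : 'I_4 := Ordinal (isT : 3 < 4)%N.

Definition mkquat (x y z t : R) : quat R := \row_(l < 4) [:: x; y; z; t]`_l.

Definition mulq a b : quat R :=
  let x l := a 0 l in let y l := b 0 l in
  mkquat (x q0 * y q0 - x q1 * y q1 - x q2 * y q2 - x q3 * y q3)
         (x q0 * y q1 + x q1 * y q0 + x q2 * y q3 - x q3 * y q2)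
         (x q0 * y q2 - x q1 * y q3 + x q2 * y q0 + x q3 * y q1)
         (x q0 * y q3 + x q1 * y q2 - x q2 * y q1 + x q3 * y q0).

Definition oneq : quat R := qbase q0.

Lemma quatP a b :
  [/\ a 0 q0 = b 0 q0, a 0 q1 = b 0 q1, a 0 q2 = b 0 q2 & a 0 q3 = b 0 q3] ->
  a = b.
Proof.
case=> e0 e1 e2 e3; apply/rowP => -[[|[|[|[|//]]]] p].
- by move: e0; congr (_ = _); congr (_ _ _); apply: val_inj.
- by move: e1; congr (_ = _); congr (_ _ _); apply: val_inj.
- by move: e2; congr (_ = _); congr (_ _ _); apply: val_inj.
- by move: e3; congr (_ = _); congr (_ _ _); apply: val_inj.
Qed.

Lemma mulqE a b : let x l := a 0 l in let y l := b 0 l in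
  [/\ mulq a b 0 q0 = x q0 * y q0 - x q1 * y q1 - x q2 * y q2 - x q3 * y q3,
      mulq a b 0 q1 = x q0 * y q1 + x q1 * y q0 + x q2 * y q3 - x q3 * y q2,
      mulq a b 0 q2 = x q0 * y q2 - x q1 * y q3 + x q2 * y q0 + x q3 * y q1 &
      mulq a b 0 q3 = x q0 * y q3 + x q1 * y q2 - x q2 * y q1 + x q3 * y q0].
Proof. by split; rewrite /mulq mxE. Qed.

Let mulq0 a b := let: And4 e _ _ _ := mulqE a b in e.
Let mulq1' a b := let: And4 _ e _ _ := mulqE a b in e.
Let mulq2 a b := let: And4 _ _ e _ := mulqE a b in e.
Let mulq3 a b := let: And4 _ _ _ e := mulqE a b in e.
Let mulqEs := (mulq0, mulq1', mulq2, mulq3).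

Lemma oneqE : [/\ oneq 0 q0 = 1, oneq 0 q1 = 0, oneq 0 q2 = 0 & oneq 0 q3 = 0].
Proof. by split; rewrite mxE. Qed.
Let oneqEs := (let: And4 e _ _ _ := oneqE in e, let: And4 _ e _ _ := oneqE in e,
  let: And4 _ _ e _ := oneqE in e, let: And4 _ _ _ e := oneqE in e).

Let addqE a b l : (a + b) 0 l = a 0 l + b 0 l. Proof. exact: mxE. Qed.
Let scaleqE (k : R) a l : (k *: a) 0 l = k * a 0 l. Proof. exact: mxE. Qed.

Fact mulqA : associative mulq.
Proof. by move=> a b c; apply: quatP; split; rewrite !mulqEs; ring. Qed.
Fact mul1q : left_id oneq mulq.
Proof. by move=> a; apply: quatP; split; rewrite !mulqEs !oneqEs; ring. Qed.
Fact mulq1 : right_id oneq mulq.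
Proof. by move=> a; apply: quatP; split; rewrite !mulqEs !oneqEs; ring. Qed.
Fact mulqDl : left_distributive mulq +%R.
Proof. by move=> a b c; apply: quatP; split; rewrite ?addqE !mulqEs ?addqE; ring. Qed.
Fact mulqDr : right_distributive mulq +%R.
Proof. by move=> a b c; apply: quatP; split; rewrite ?addqE !mulqEs ?addqE; ring. Qed.
Fact oneq_neq0 : oneq != 0.
Proof. by apply/eqP => /rowP /(_ q0); rewrite oneqEs mxE; apply/eqP/oner_neq0. Qed.

HB.instance Definition _ := GRing.Zmodule_isNzRing.Build (quat R)
  mulqA mul1q mulq1 mulqDl mulqDr oneq_neq0.

Fact scaleqAl (k : R) a b : k *: (a * b) = (k *: a) * b.
Proof. by apply: quatP; split; rewrite ?scaleqE !mulqEs ?scaleqE; ring. Qed.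
HB.instance Definition _ := GRing.Lmodule_isLalgebra.Build R (quat R) scaleqAl.
Fact scaleqAr (k : R) a b : k *: (a * b) = a * (k *: b).
Proof. by apply: quatP; split; rewrite ?scaleqE !mulqEs ?scaleqE; ring. Qed.
HB.instance Definition _ := GRing.Lalgebra_isAlgebra.Build R (quat R) scaleqAr.

Lemma quat_basisE :
  [/\ qbase q1 * qbase q1 = -1, qbase q2 * qbase q2 = -1,
      qbase q3 * qbase q3 = -1 & qbase q1 * qbase q2 * qbase q3 = -1].
Proof.
have oppqE a l : (- a) 0 l = - a 0 l by exact: mxE.
by split; apply: quatP; split; rewrite !mulqEs !oppqE oneqEs !mxE /=; ring.
Qed.

Definition imunit : set (quat R) := [set q | q ^+ 2 = -1].

Lemma imunitN q : imunit q -> imunit (- q).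
Proof. by rewrite /imunit /= sqrrN. Qed.

Lemma imunitP q : imunit q ->
  q 0 q0 = 0 /\ q 0 q1 ^+ 2 + q 0 q2 ^+ 2 + q 0 q3 ^+ 2 = 1.
Proof.
have oppqE a l : (- a) 0 l = - a 0 l by exact: mxE.
rewrite /imunit /= expr2 => /rowP qq.
have := (qq q0, qq q1, qq q2, qq q3).
rewrite !oppqE !oneqEs !mulqEs.
set a := q 0 q0; set b := q 0 q1; set c := q 0 q2; set d := q 0 q3.
move=> [[[e0 e1] e2] e3].
have a0 : a = 0.
  apply/eqP; apply: contraT => an0.
  have e x : 2 * (a * x) = 0 -> x = 0.
    by move/eqP; rewrite !mulf_eq0 pnatr_eq0 (negbTE an0) => /eqP.
  have b0 : b = 0 by apply: e; rewrite -[RHS]oppr0 -e1; ring.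
  have c0 : c = 0 by apply: e; rewrite -[RHS]oppr0 -e2; ring.
  have d0 : d = 0 by apply: e; rewrite -[RHS]oppr0 -e3; ring.
  move: e0; rewrite b0 c0 d0 !mul0r !subr0 -expr2 => e0.
  by have := sqr_ge0 a; rewrite e0 oppr_ge0 ler10.
split=> //; apply: oppr_inj; rewrite -e0 a0; ring.
Qed.

End Quaternions.

Section SliceFunctions.
Variables (R : realType) (n : nat).
Local Notation C := R[i].
Local Notation H := (quat R).
Implicit Types (D : set 'rV[C]_n) (z : 'rV[C]_n) (J x : 'rV[H]_n).
Implicit Types (h : 'I_n) (K : {set 'I_n}).

Definition set_coord (T : Type) h (x : 'rV[T]_n) (t : T) : 'rV[T]_n :=
  \row_l (if l == h then t else x 0 l).

Definition conj_coord h z : 'rV[C]_n := set_coord h z (conjc (z 0 h)).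

Definition conj_invariant D := forall h z, D z <-> D (conj_coord h z).

Definition qpoint z J : 'rV[H]_n :=
  \row_l ((complex.Re (z 0 l))%:A + complex.Im (z 0 l) *: J 0 l).

Definition imunits : set 'rV[H]_n := [set J | forall l, imunit (J 0 l)].

Definition circularization D : set 'rV[H]_n :=
  [set qpoint z J | z in D & J in imunits].

(* H (x) R^(2^n): the element \sum_K e_K a_K is the family (a_K)_K. *)
Local Notation HR := {ffun {set 'I_n} -> H}.

Definition tens K (a : H) : HR := [ffun L => if L == K then a else 0].

(* q_K = q_{k_1} ... q_{k_p}: the index enumeration of 'I_n is increasing, so
   this noncommutative product is taken in increasing order of the indices. *)
Definition qprod K J : H := \prod_(k in K) J 0 k.

(* Stem functions are total functions; only their values on D matter. *)
Definition stem D (F : 'rV[C]_n -> HR) :=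
  forall K h z, D z ->
    F (conj_coord h z) K = (-1) ^+ #|K :&: [set h]| * F z K.

Definition slice_value (F : 'rV[C]_n -> HR) z J : H :=
  \sum_(K : {set 'I_n}) qprod K J * F z K.

(* I(F): a point x of the circularization has several representations
   x = alpha + J beta; one of them is chosen. The value does not depend on the
   choice when D is conj_invariant and F is a stem function on D (lemma
   slice_funE). Off the circularization of D the value is meaningless. *)
Definition slice_fun D (F : 'rV[C]_n -> HR) x : H :=
  let zJ := xget (0, 0) [set zJ : 'rV[C]_n * 'rV[H]_n |
                          [/\ D zJ.1, imunits zJ.2 & x = qpoint zJ.1 zJ.2]] in
  slice_value F zJ.1 zJ.2.

Definition induces D (F : 'rV[C]_n -> HR) (f : 'rV[H]_n -> H) :=
  stem D F /\ (forall x, circularization D x -> f x = slice_fun D F x).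

(* t |-> F_K(z) where alpha_h (resp. beta_h) is replaced by t *)
Definition alpha_line h (F : 'rV[C]_n -> HR) K z (t : R) : H :=
  F (set_coord h z (t +i* complex.Im (z 0 h))) K.
Definition beta_line h (F : 'rV[C]_n -> HR) K z (t : R) : H :=
  F (set_coord h z (complex.Re (z 0 h) +i* t)) K.

Definition dalpha h (F : 'rV[C]_n -> HR) z : HR :=
  [ffun K => derive1 (alpha_line h F K z) (complex.Re (z 0 h))].
Definition dbeta h (F : 'rV[C]_n -> HR) z : HR :=
  [ffun K => derive1 (beta_line h F K z) (complex.Im (z 0 h))].

Definition classC1 D (F : 'rV[C]_n -> HR) :=
  forall h K z, D z ->
  [/\ derivable (alpha_line h F K z) (complex.Re (z 0 h)) 1,
      derivable (beta_line h F K z) (complex.Im (z 0 h)) 1,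
      {for z, continuous (fun w => dalpha h F w K)} &
      {for z, continuous (fun w => dbeta h F w K)}].

Definition sliceC1 D (f : 'rV[H]_n -> H) :=
  exists F, induces D F f /\ classC1 D F.

(* The stem function inducing f; its values on D are uniquely determined
   (lemma induces_inj). *)
Definition stem_of D (f : 'rV[H]_n -> H) : 'rV[C]_n -> HR :=
  xget (fun=> 0) [set F | induces D F f].

Definition opJ h (a : HR) : HR :=
  \sum_(K : {set 'I_n})
    (if h \in K then - tens (K :\ h) (a K) else tens (h |: K) (a K)).

Definition dbar_stem h (F : 'rV[C]_n -> HR) z : HR :=
  2^-1 *: (dalpha h F z + opJ h (dbeta h F z)).

(* the derivative of f with respect to x_h^c *)
Definition slice_dbar D h (f : 'rV[H]_n -> H) : 'rV[H]_n -> H :=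
  slice_fun D (dbar_stem h (stem_of D f)).

Definition real_coordC h : set 'rV[C]_n := [set z | complex.Im (z 0 h) = 0].
Definition real_coordH h : set 'rV[H]_n := [set x | exists a : R, x 0 h = a%:A].

Definition spherical_stem h (F : 'rV[C]_n -> HR) z : HR :=
  (complex.Im (z 0 h))^-1 *:
    \sum_(K : {set 'I_n} | h \notin K) tens K (F z (h |: K)).

(* f'_{s,h}, meaningful on circularization D `\` real_coordH h *)
Definition spherical_deriv D h (f : 'rV[H]_n -> H) : 'rV[H]_n -> H :=
  slice_fun (D `\` real_coordC h) (spherical_stem h (stem_of D f)).

Definition coord_map h (g : 'rV[H]_n -> H) x (q : H) : H := g (set_coord h x q).

Definition laplacian h (g : 'rV[H]_n -> H) x : H :=
  \sum_(i < 4) 'D_(qbase R i) ('D_(qbase R i) (coord_map h g x)) (x 0 h).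

(* Derivatives are total in the library, with an arbitrary value where the
   limit does not exist: this is the existence of the iterated partial
   derivatives that occur in the laplacian. *)
Definition laplacian_defined h (g : 'rV[H]_n -> H) x :=
  forall i : 'I_4, (\forall q \near x 0 h, derivable (coord_map h g x) q (qbase R i)) /\
    derivable ('D_(qbase R i) (coord_map h g x)) (x 0 h) (qbase R i).

Lemma imag_unit_ex : imunit (qbase R q1).
Proof. by rewrite /imunit /= expr2; case: (quat_basisE R). Qed.

Lemma opJE h (a : HR) L :
  opJ h a L = if h \in L then a (L :\ h) else - a (h |: L).
Proof.
rewrite /opJ sum_ffunE; case: ifPn => hL.
  rewrite (bigD1 (L :\ h)) //= !inE eqxx /= ffunE finset.setD1K // eqxx.
  rewrite big1 ?addr0 // => K KL; case: ifPn => hK; rewrite !ffunE.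
    case: eqP => [e|_]; last by rewrite oppr0.
    by move: hL; rewrite e !inE eqxx.
  case: eqP => // e; case/eqP: KL; rewrite e finset.setU1K //.
rewrite (bigD1 (h |: L)) //= !inE eqxx /= !ffunE finset.setU1K // eqxx.
rewrite big1 ?addr0 // => K KL; case: ifPn => hK; rewrite !ffunE.
  case: eqP => [e|_]; last by rewrite oppr0.
  by case/eqP: KL; rewrite e finset.setD1K.
by case: eqP => // e; move: hL; rewrite e !inE eqxx.
Qed.

Lemma spherical_stemE h F z L : spherical_stem h F z L =
  if h \in L then 0 else (complex.Im (z 0 h))^-1 *: F z (h |: L).
Proof.
rewrite /spherical_stem ffunE sum_ffunE; case: ifPn => hL.
  rewrite big1 ?scaler0 // => K hK; rewrite ffunE; case: eqP => // e.
  by rewrite -e hL in hK.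
rewrite (bigD1 L) //= ffunE eqxx big1 ?addr0 // => K /andP[_ KL].
by rewrite ffunE eq_sym (negbTE KL).
Qed.

Lemma qpoint_coord z J l : imunits J ->
  [/\ qpoint z J 0 l 0 q0 = complex.Re (z 0 l),
      qpoint z J 0 l 0 q1 = complex.Im (z 0 l) * J 0 l 0 q1,
      qpoint z J 0 l 0 q2 = complex.Im (z 0 l) * J 0 l 0 q2 &
      qpoint z J 0 l 0 q3 = complex.Im (z 0 l) * J 0 l 0 q3].
Proof.
move=> /(_ l)/imunitP[J0 _]; case: (oneqE R) => e0 e1 e2 e3.
have E i : qpoint z J 0 l 0 i =
    complex.Re (z 0 l) * oneq R 0 i + complex.Im (z 0 l) * J 0 l 0 i.
  by rewrite mxE [LHS]mxE; congr (_ + _); exact: mxE.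
by rewrite !E J0 e0 e1 e2 e3 mulr1 !mulr0 !add0r addr0.
Qed.

Lemma qpoint_eq z z' J J' : imunits J -> imunits J' ->
  qpoint z J = qpoint z' J' -> forall l,
  [\/ z' 0 l = z 0 l /\ J' 0 l = J 0 l,
      z' 0 l = conjc (z 0 l) /\ J' 0 l = - J 0 l |
      z' 0 l = z 0 l /\ complex.Im (z 0 l) = 0].
Proof.
move=> uJ uJ' e l.
have := congr1 (fun x : 'rV[H]_n => x 0 l) e => {e} /= e.
case: (qpoint_coord z l uJ) => x0 x1 x2 x3.
case: (qpoint_coord z' l uJ'); rewrite -e x0 x1 x2 x3 {e x0 x1 x2 x3}.
have [J0 JJ] := imunitP (uJ l); have [J0' JJ'] := imunitP (uJ' l).
move: J0 JJ J0' JJ'; set j := J 0 l; set j' := J' 0 l.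
case: (z 0 l) => a b; case: (z' 0 l) => a' b' /= J0 JJ J0' JJ' <- e1 e2 e3.
have bb : b ^+ 2 = b' ^+ 2.
  by rewrite -[LHS]mulr1 -[RHS]mulr1 -{1}JJ -JJ' !mulrDr -!exprMn e1 e2 e3.
have [b0|bn0] := eqVneq b 0.
  apply: Or33; split=> //; congr (_ +i* _).
  by rewrite b0; apply/eqP; move: bb; rewrite b0 expr0n /= => /esym/eqP;
     rewrite expf_eq0.
have oppqE (a0 : H) i : (- a0) 0 i = - a0 0 i by exact: mxE.
move/eqP: bb; rewrite eqf_sqr => /orP[]/eqP bb.
  apply: Or31; split; first by rewrite -bb.
  by apply: quatP; split; first (by rewrite J0 J0'); apply: (mulfI bn0);
    rewrite ?e1 ?e2 ?e3 -bb ?e1 ?e2 ?e3 bb.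
apply: Or32; split; first by rewrite /conjc bb opprK.
by apply: quatP; split; rewrite !oppqE; first (by rewrite J0 J0' oppr0);
  apply: (mulfI bn0); rewrite mulrN ?e1 ?e2 ?e3 bb mulNr ?opprK.
Qed.

Lemma set_coordE (T : Type) h (x : 'rV[T]_n) t l :
  set_coord h x t 0 l = if l == h then t else x 0 l.
Proof. exact: mxE. Qed.

Lemma set_coord_id (T : Type) h (x : 'rV[T]_n) : set_coord h x (x 0 h) = x.
Proof. by apply/rowP => l; rewrite set_coordE; case: eqP => [->|]. Qed.

Lemma card_setI1 h K : #|K :&: [set h]| = (h \in K).
Proof.
case: (boolP (h \in K)) => hK.
  by rewrite (_ : _ :&: _ = [set h]%SET) ?cards1 //; apply/finset.setIidPr; rewrite finset.sub1set.
apply/eqP; rewrite cards_eq0; apply/eqP/finset.setP => l; rewrite !inE.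
by case: eqP => [->|]; rewrite ?andbF // (negbTE hK).
Qed.

Definition conj_coords (s : seq 'I_n) z := foldr conj_coord z s.

Lemma conj_coords_in D F s z : conj_invariant D -> stem D F -> D z ->
  D (conj_coords s z) /\ forall K,
  F (conj_coords s z) K = (\prod_(h <- s) (-1) ^+ (h \in K) : R) *: F z K.
Proof.
move=> cD sF Dz; elim: s => [|h s [Ds IH]] /=.
  by split=> // K; rewrite big_nil scale1r.
split; first by case: (cD h (conj_coords s z)) => + _; exact.
move=> K; rewrite sF // card_setI1 IH big_cons -scalerA.
by case: (h \in K); rewrite ?expr0 ?expr1 ?mul1r ?scale1r // mulN1r scaleN1r.
Qed.

Lemma conj_coordsE s z l : uniq s ->
  conj_coords s z 0 l = if l \in s then conjc (z 0 l) else z 0 l.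
Proof.
elim: s => //= h s IH /andP[hs us]; rewrite set_coordE in_cons.
by case: eqP hs => [<-|_] hs; rewrite IH // (negbTE hs).
Qed.

Lemma stem_real D F z l K : stem D F -> D z -> complex.Im (z 0 l) = 0 ->
  l \in K -> F z K = 0.
Proof.
move=> sF Dz zl lK; have := sF K l z Dz.
rewrite card_setI1 lK expr1 mulN1r.
rewrite (_ : conj_coord l z = z); last first.
  rewrite -[RHS](set_coord_id l); congr set_coord.
  by move: zl; case: (z 0 l) => a b /= ->; rewrite oppr0.
move=> /eqP; rewrite -addr_eq0 -mulr2n -scaler_nat scaler_eq0 pnatr_eq0.
by move/eqP.
Qed.

Lemma qprodZ (e : 'I_n -> R) K J J' :
  (forall k, k \in K -> J' 0 k = e k *: J 0 k) ->
  qprod K J' = (\prod_(k in K) e k) *: qprod K J.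
Proof. by move=> eJ; rewrite /qprod -scaler_prod; apply: eq_bigr. Qed.

Lemma slice_value_unique D F z z' J J' : conj_invariant D -> stem D F ->
  D z -> imunits J -> imunits J' -> qpoint z J = qpoint z' J' ->
  slice_value F z J = slice_value F z' J'.
Proof.
move=> cD sF Dz uJ uJ' e; have E := qpoint_eq uJ uJ' e.
pose s := [seq l <- enum 'I_n | z' 0 l != z 0 l].
have us : uniq s by rewrite filter_uniq ?enum_uniq.
have sE l : (l \in s) = (z' 0 l != z 0 l) by rewrite mem_filter mem_enum andbT.
have z'E : z' = conj_coords s z.
  apply/rowP => l; rewrite conj_coordsE // sE.
  by case: eqP => //= zl; case: (E l) => [[]|[]|[]].
have [_ Fs] := conj_coords_in s cD sF Dz.
apply: eq_bigr => K _; rewrite z'E Fs.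
have [[l lK zl]|nz] := pselect (exists2 l, l \in K & complex.Im (z 0 l) = 0).
  by rewrite (stem_real sF Dz zl lK) scaler0 !mulr0.
have eJ k : k \in K -> J' 0 k = (-1) ^+ (k \in s) *: J 0 k.
  move=> kK; have zk : complex.Im (z 0 k) <> 0 by move=> zk; apply: nz; exists k.
  rewrite sE; case: (E k) => -[-> // ->]; first by rewrite eqxx scale1r.
  rewrite (_ : (_ != _) = true) ?scaleN1r //; apply/eqP; move: zk.
  case: (z 0 k) => a b /= b0 [] /eqP; rewrite eq_sym -addr_eq0 -mulr2n.
  by rewrite mulrn_eq0 => /eqP.
rewrite (qprodZ eJ) -scalerAl -scalerAr scalerA.
rewrite (big_uniq _ us) /= !(big_mkcond (fun k => k \in _)) /= -big_split big1 ?scale1r // => k _.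
by case: (k \in K); case: (k \in s); rewrite /= ?expr0 ?expr1 ?mulr1 // mulrNN mulr1.
Qed.

Lemma slice_funE D F z J : conj_invariant D -> stem D F -> D z -> imunits J ->
  slice_fun D F (qpoint z J) = slice_value F z J.
Proof.
move=> cD sF Dz uJ; rewrite /slice_fun; case: xgetP => [zJ _ /= []|]; last first.
  by move=> /(_ (z, J)) /=; case.
by move=> Dz' uJ' e; rewrite -(slice_value_unique cD sF Dz uJ uJ' e).
Qed.

Lemma circularization_real D h :
  circularization (D `\` real_coordC h) = circularization D `\` real_coordH h.
Proof.
have R1 z J : imunits J -> real_coordH h (qpoint z J) <-> real_coordC h z.
  move=> uJ; have [_ h1] := imunitP (uJ h).
  case: (qpoint_coord z h uJ) => e0 e1 e2 e3; case: (oneqE R) => o0 o1 o2 o3.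
  have aE (a : R) i : (a%:A : H) 0 i = a * oneq R 0 i by exact: mxE.
  split=> [[a e]|z0]; rewrite /real_coordC /=.
    move: e1 e2 e3; rewrite e !aE o1 o2 o3 mulr0 => e1 e2 e3.
    apply/eqP; rewrite -sqrf_eq0 -[X in X == 0]mulr1 -h1 !mulrDr -!exprMn.
    by rewrite -e1 -e2 -e3 expr0n /= !addr0.
  exists (complex.Re (z 0 h)); rewrite mxE.
  by move: z0; rewrite /real_coordC /= => ->; rewrite scale0r addr0.
apply/seteqP; split=> [_ [z [Dz zh] [J uJ <-]]|_ [[z Dz [J uJ <-]] zh]].
  split; first by exists z => //; exists J.
  by move/(R1 _ _ uJ).
by exists z; [split=> // ?; apply/zh/R1|exists J].
Qed.

Lemma induces_inj D F G f : conj_invariant D ->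
  induces D F f -> induces D G f -> forall z, D z -> F z = G z.
Proof.
move=> cD [sF fF] [sG fG] z Dz; pose a K := F z K - G z K.
have a0 J : imunits J -> \sum_K qprod K J * a K = 0.
  move=> uJ; have cx : circularization D (qpoint z J) by exists z => //; exists J.
  have := fF _ cx; rewrite fG // !slice_funE // /slice_value => /esym/eqP.
  by rewrite -subr_eq0 -sumrB => /eqP e; rewrite -[RHS]e;
    apply: eq_bigr => K _; rewrite mulrBr.
pose J : 'rV[H]_n := \row_l qbase R q1.
have uJ : imunits J by move=> l; rewrite mxE; exact: imag_unit_ex.
apply/ffunP => L; apply/eqP; rewrite -subr_eq0 -/(a L).
pose t (A : {set 'I_n}) K : R := \prod_(k in K) (if k \in A then -1 else 1).
have tE A K : t A K = \prod_k (if k \in A then (if k \in K then -1 else 1) else 1).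
  by rewrite /t big_mkcond; apply: eq_bigr => k _; do 2!case: ifP.
have sumt K : \sum_A t A L * t A K = if K == L then 2 ^+ n else 0.
  pose u k : R := if k \in L then if k \in K then 1 else -1
                  else if k \in K then -1 else 1.
  transitivity (\prod_k (u k + 1)).
    rewrite bigA_distr; apply: eq_bigr => A _; rewrite (tE A L) (tE A K) -big_split /=.
    apply: eq_bigr => k _; rewrite /u /=.
    by case: (k \in A); case: (k \in L); case: (k \in K); rewrite ?mulrNN ?mulr1 ?mul1r.
  have [e|KL] := eqVneq K L.
    rewrite (eq_bigr (fun=> 2)) ?prodr_const ?card_ord // => k _.
    by rewrite /u e; case: (k \in L).
  have [k] : exists k, (k \in K) != (k \in L).
    apply/existsP; apply: contraR KL; rewrite negb_exists => /forallP KL.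
    by apply/eqP/finset.setP => k; apply/eqP; have := KL k; rewrite negbK.
  move=> kKL; rewrite (bigD1 k) //= /u.
  by case: (k \in L) kKL => /=; case: (k \in K) => //= _; rewrite addNr mul0r.
pose JA (A : {set 'I_n}) : 'rV[H]_n := \row_l ((if l \in A then -1 else 1 : R) *: J 0 l).
have : \sum_A t A L *: (\sum_K qprod K (JA A) * a K) = 0.
  rewrite big1 // => A _; rewrite a0 ?scaler0 // => l.
  by rewrite mxE; case: ifP => _; rewrite ?scale1r // scaleN1r; apply: imunitN.
under eq_bigr do rewrite scaler_sumr.
rewrite exchange_big /=.
have qE A K : qprod K (JA A) = t A K *: qprod K J.
  by apply: qprodZ => k _; rewrite mxE.
have E K : \sum_A t A L *: (qprod K (JA A) * a K) =
    (if K == L then 2 ^+ n else 0) *: (qprod K J * a K).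
  rewrite -sumt scaler_suml; apply: eq_bigr => A _.
  by rewrite qE -scalerAl scalerA.
under eq_bigr do rewrite E.
rewrite (bigD1 L) //= eqxx big1 ?addr0; last first.
  by move=> K /negbTE->; rewrite scale0r.
move/eqP; rewrite scaler_eq0 expf_eq0 pnatr_eq0 andbF /= => /eqP.
have unit_ex K : exists b : H, b * qprod K J = 1.
  rewrite /qprod; elim/big_rec: _ => [|k y _ [b by1]]; first by exists 1; rewrite mulr1.
  exists (- b * J 0 k); have Jk := uJ k; rewrite /imunit /= expr2 in Jk.
  by rewrite -mulrA (mulrA (J 0 k)) Jk mulN1r mulrNN.
by have [b bL] := unit_ex L => e; rewrite -[a L]mul1r -bL -mulrA e mulr0.
Qed.

End SliceFunctions.

(* Main.v *)
Require Import Defs.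
From mathcomp Require Import all_boot all_order all_algebra.
From mathcomp Require Import boolp classical_sets reals constructive_ereal.
From mathcomp Require Import topology normedtype derive realfun trigo.
From mathcomp Require Import measure lebesgue_measure lebesgue_integral ftc.
From mathcomp Require Import complex ring lra.
Set Implicit Arguments.
Unset Strict Implicit.
Unset Printing Implicit Defensive.
Import Order.TTheory GRing.Theory Num.Theory numFieldNormedType.Exports.
Local Open Scope classical_set_scope.
Local Open Scope ring_scope.
Local Open Scope complex_scope.

(** Write f = I(F) and, for a set K of indices with h outside K, put
    u = F_K and v = F_(K u h), seen as functions of z_h = alpha + i beta while
    the other coordinates are fixed.  The vanishing of the derivative of f with
    respect to x_h^c says exactly that the components of u + i v satisfy the
    Cauchy-Riemann equations in z_h (cauchy_riemann_stem).  At a point x whose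
    h-th coordinate q = alpha + r I is not real, r > 0 being the norm of the
    imaginary part of q, the spherical derivative is the sum over these K of
    J_K v(alpha, r) / r, because h is not in K and J_K does not involve I
    (slice_spherical).  So everything reduces to the functions v(q_0, r) / r of
    a quaternion q, for which the laplacian of R^4 is
    (v_(alpha alpha) + v_(beta beta)) / r, the terms of lower order cancelling
    (axial_harmonic); and v is harmonic as the imaginary part of a holomorphic
    function.

    The stem function is only assumed to be of class C^1, whereas second
    derivatives of v are needed.  They come from Cauchy's integral formula on
    a circle gamma around the point (cauchy_formula), proved for C^1 solutions
    of the Cauchy-Riemann equations: the integral of
    F(w + l (gamma - w)) gamma' / (gamma - w) over the parameter of gamma has
    a derivative in l which is the integral of F'(w + l (gamma - w)) gamma',
    that is 1/l times the integral of a total derivative along a closed curve,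
    so it does not depend on l; l = 1 gives the Cauchy integral and l = 0 gives
    F(w) times the integral of gamma' / (gamma - w), which is 2 i pi.  The
    Cauchy integral can be differentiated twice under the integral sign in any
    direction d, and the second derivative is d ^ 2 times a complex number that
    does not depend on d.  Comparing d = 1 with d = i gives both the existence
    of the two pure second derivatives of v and the vanishing of their sum
    (cauchy_riemann_harmonic).  Complex quantities are handled through their
    real and imaginary parts, since the integrals are real. *)

(** * One-variable calculus and the chain rule along plane curves *)

Section Calculus.
Variable R : realType.
Implicit Types f g c : R -> R.

Lemma is_derive1_continuous f (x df : R) :
  is_derive x 1 f df -> {for x, continuous f}.
Proof. by case=> /derivable1_diffP/differentiable_continuous. Qed.

Lemma derive0_segment f (x y : R) : x <= y ->
  (forall z, x <= z <= y -> derivable f z 1) ->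
  (forall z, x < z < y -> 'D_1 f z = 0) -> f y = f x.
Proof.
move=> xy fd f0; apply/eqP; rewrite -subr_eq0.
have [||c _ ->] := @MVT_segment R f (fun=> 0) x y xy.
- move=> z; rewrite in_itv => /= zxy; rewrite -(f0 _ zxy).
  by apply/derivableP/fd; case/andP: zxy => /ltW -> /ltW ->.
- by apply: derivable_within_continuous => z; rewrite in_itv => /= /fd.
by rewrite mul0r.
Qed.

(** Mean value theorem between x and y in either order. *)
Lemma mvt_norm f df (x y : R) :
  (forall z, `|z - x| <= `|y - x| -> is_derive z 1 f (df z)) ->
  exists2 z, `|z - x| <= `|y - x| & f y - f x = df z * (y - x).
Proof.
move=> fd; have fc (a b : R) : (forall z, a <= z <= b -> `|z - x| <= `|y - x|) ->
    {within `[a, b], continuous f}.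
  move=> ab; apply: derivable_within_continuous => z; rewrite in_itv => /= zab.
  by case: (fd z (ab _ zab)).
have [xy|/ltW yx] := leP x y.
  have le z : x <= z <= y -> `|z - x| <= `|y - x|.
    by case/andP=> xz zy; rewrite !ger0_norm ?subr_ge0// lerD2r.
  have [||z zxy e] := @MVT_segment R f df x y xy.
  - by move=> z; rewrite in_itv => /= /andP[/ltW xz /ltW zy]; apply/fd/le/andP.
  - exact/fc/le.
  by exists z => //; apply: le; rewrite in_itv in zxy.
have le z : y <= z <= x -> `|z - x| <= `|y - x|.
  by case/andP=> yz zx; rewrite !ler0_norm ?subr_le0// lerN2 lerD2r.
have [||z zxy e] := @MVT_segment R f df y x yx.
- by move=> z; rewrite in_itv => /= /andP[/ltW xz /ltW zy]; apply/fd/le/andP.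
- exact/fc/le.
exists z; first by apply: le; rewrite in_itv in zxy.
by rewrite -[LHS]opprB e -mulrN opprB.
Qed.

Lemma is_derive1P f (t d : R) :
  is_derive t 1 f d <-> h^-1 * (f (h + t) - f t) @[h --> 0^'] --> d.
Proof.
have E : (fun h : R => h^-1 *: ((f \o shift t) (h *: (1 : R)) - f t)) =
    (fun h => h^-1 * (f (h + t) - f t)).
  by apply/funext => h; rewrite /= [_%:A]mulr1.
split=> [[df <-]|fd].
  by move: df; rewrite /derivable E => /cvgP; rewrite /derive E.
have : derivable f t 1 by rewrite /derivable E; apply/cvg_ex; exists d.
by move/DeriveDef; apply; rewrite /derive E; apply/cvg_lim.
Qed.

(** Continuity of the partial derivatives at the point is what makes the chain
    rule hold: each of the two increments of f, first in x and then in y, is a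
    partial derivative at an intermediate point (mvt_norm), and intermediate
    points converge to the base point together with the curve. *)
Lemma is_derive_curve (f fx fy : R -> R -> R) c1 c2 (t d1 d2 e : R) : 0 < e ->
  (forall x y, `|x - c1 t| < e -> `|y - c2 t| < e ->
     is_derive x 1 (f^~ y) (fx x y) /\ is_derive y 1 (f x) (fy x y)) ->
  {for (c1 t, c2 t), continuous (fun p : R * R => fx p.1 p.2)} ->
  {for (c1 t, c2 t), continuous (fun p : R * R => fy p.1 p.2)} ->
  is_derive t 1 c1 d1 -> is_derive t 1 c2 d2 ->
  is_derive t 1 (fun s => f (c1 s) (c2 s))
    (fx (c1 t) (c2 t) * d1 + fy (c1 t) (c2 t) * d2).
Proof.
move=> e0 fe cfx cfy dc1 dc2; apply/is_derive1P.
have cvgc c d : is_derive t 1 c d -> c (h + t) @[h --> 0^'] --> c t.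
  by move=> /is_derive1_continuous cc; exact/continuous_withinNshiftx.
have near_c c d : is_derive t 1 c d ->
    \forall h \near 0^', `|c (h + t) - c t| < e.
  by move=> /cvgc /cvgrPdistC_lt; exact.
(* xi h and eta h are the intermediate points of the two increments; the
   value 0 is a dummy for the h that are too large. *)
have near1 := near_c _ _ dc1; have near2 := near_c _ _ dc2.
have /choice[xi xiP] : forall h, exists x, `|c1 (h + t) - c1 t| < e ->
    `|c2 (h + t) - c2 t| < e -> `|x - c1 t| <= `|c1 (h + t) - c1 t| /\
    f (c1 (h + t)) (c2 (h + t)) - f (c1 t) (c2 (h + t)) =
    fx x (c2 (h + t)) * (c1 (h + t) - c1 t).
  move=> h.
  have [h1|_] := ltP `|c1 (h + t) - c1 t| e; last by exists 0.
  have [h2|_] := ltP `|c2 (h + t) - c2 t| e; last by exists 0.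
  have [|x xc fxE] := @mvt_norm (f^~ (c2 (h + t))) (fx^~ (c2 (h + t)))
    (c1 t) (c1 (h + t)); last by exists x.
  by move=> z /le_lt_trans/(_ h1) zc; case: (fe _ _ zc h2).
have /choice[eta etaP] : forall h, exists x, `|c2 (h + t) - c2 t| < e ->
    `|x - c2 t| <= `|c2 (h + t) - c2 t| /\
    f (c1 t) (c2 (h + t)) - f (c1 t) (c2 t) =
    fy (c1 t) x * (c2 (h + t) - c2 t).
  move=> h.
  have [h2|_] := ltP `|c2 (h + t) - c2 t| e; last by exists 0.
  have [|x xc fxE] := @mvt_norm (f (c1 t)) (fy (c1 t)) (c2 t) (c2 (h + t));
    last by exists x.
  move=> z /le_lt_trans/(_ h2) zc.
  by case: (fe (c1 t) _ _ zc); rewrite ?subrr ?normr0.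
have squeeze (c z : R -> R) (d : R) : is_derive t 1 c d ->
    (\forall h \near 0^', `|z h - c t| <= `|c (h + t) - c t|) ->
    z h @[h --> 0^'] --> c t.
  move=> /cvgc /cvgrPdistC_le cc zc; apply/cvgrPdistC_le => k k0.
  near=> h; apply: (@le_trans _ _ `|c (h + t) - c t|).
    by near: h.
  by near: h; exact: cc.
have cvgxi : fx (xi h) (c2 (h + t)) @[h --> 0^'] --> fx (c1 t) (c2 t).
  suff xc : xi h @[h --> 0^'] --> c1 t.
    exact: cvg_comp (cvg_pair xc (cvgc _ _ dc2)) cfx.
  apply: squeeze dc1 _; near=> h.
  by have [||] := xiP h; [near: h..|].
have cvgeta : fy (c1 t) (eta h) @[h --> 0^'] --> fy (c1 t) (c2 t).
  suff xc : eta h @[h --> 0^'] --> c2 t.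
    by apply: cvg_comp (cvg_pair _ xc) cfy; exact: cvg_cst.
  apply: squeeze dc2 _; near=> h.
  by have [|] := etaP h; [near: h|].
move/is_derive1P in dc1; move/is_derive1P in dc2.
apply: cvg_trans (cvgD (cvgM cvgxi dc1) (cvgM cvgeta dc2)).
apply: near_eq_cvg; near=> h => /=.
have h1 : `|c1 (h + t) - c1 t| < e by near: h.
have h2 : `|c2 (h + t) - c2 t| < e by near: h.
have [_ e1] := xiP h h1 h2; have [_ e2] := etaP h h2.
transitivity (h^-1 * (fx (xi h) (c2 (h + t)) * (c1 (h + t) - c1 t)) +
    h^-1 * (fy (c1 t) (eta h) * (c2 (h + t) - c2 t))).
  by congr (_ + _); exact: mulrCA.
by rewrite -e1 -e2 -mulrDr addrA subrK.
Unshelve. all: by end_near. Qed.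

(** The differentiation rules, on functions written pointwise, so that the
    tactic der below can choose them by the shape of the function. *)
Lemma der_cst (r x : R) : is_derive x 1 (fun _ : R => r) 0.
Proof. exact: is_derive_cst. Qed.

Lemma der_id (x : R) : is_derive x 1 (fun z : R => z) 1.
Proof. exact: is_derive_id. Qed.

Lemma der_add f g (x a b : R) : is_derive x 1 f a -> is_derive x 1 g b ->
  is_derive x 1 (fun z => f z + g z) (a + b).
Proof. by move=> df dg; exact: is_deriveD. Qed.

Lemma der_opp f (x a : R) : is_derive x 1 f a ->
  is_derive x 1 (fun z => - f z) (- a).
Proof. by move=> df; exact: is_deriveN. Qed.

Lemma der_mul f g (x a b : R) : is_derive x 1 f a -> is_derive x 1 g b ->
  is_derive x 1 (fun z => f z * g z) (f x * b + g x * a).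
Proof. by move=> df dg; exact: is_deriveM. Qed.

Lemma der_sqr f (x a : R) : is_derive x 1 f a ->
  is_derive x 1 (fun z => f z ^+ 2) (2 * f x * a).
Proof.
by move=> df; apply: (is_derive_eq (der_mul df df)); ring.
Qed.

Lemma der_inv f (x a : R) : f x != 0 -> is_derive x 1 f a ->
  is_derive x 1 (fun z => (f z)^-1) (- (f x)^-1 ^+ 2 * a).
Proof.
by move=> fx0 df; apply: (is_derive_eq (is_deriveV fx0 df)); rewrite exprVn.
Qed.

Lemma der_comp f g (x a b : R) : is_derive (g x) 1 f a -> is_derive x 1 g b ->
  is_derive x 1 (fun z => f (g z)) (a * b).
Proof. by move=> df dg; exact: is_derive1_comp. Qed.

Lemma cts_add f g : continuous f -> continuous g ->
  continuous (fun t => f t + g t).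
Proof. by move=> fc gc t; apply: continuousD; [exact: fc|exact: gc]. Qed.

Lemma cts_opp f : continuous f -> continuous (fun t => - f t).
Proof. by move=> fc t; apply: continuousN; exact: fc. Qed.

Lemma cts_mul f g : continuous f -> continuous g ->
  continuous (fun t => f t * g t).
Proof. by move=> fc gc t; apply: continuousM; [exact: fc|exact: gc]. Qed.

Lemma cts_sqr f : continuous f -> continuous (fun t => f t ^+ 2).
Proof. by move=> fc; exact: cts_mul. Qed.

Lemma cts_cst (r : R) : continuous (fun _ : R => r).
Proof. exact: cst_continuous. Qed.

End Calculus.

(** Computes a derivative from the shape of the function and from the
    derivatives of its parts found among the hypotheses; what remains is the
    equality of the result with the announced derivative, after the conditions
    that the denominators do not vanish. *)
Ltac der_rec := lazymatch goal with
  | |- is_derive _ _ (fun z => cos z) _ => exact: is_derive_cos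
  | |- is_derive _ _ (fun z => sin z) _ => exact: is_derive_sin
  | |- is_derive _ _ (fun _ => ?c) _ => exact: der_cst
  | |- is_derive _ _ (fun z => z) _ => exact: der_id
  | |- is_derive _ _ (fun z => @?f z + @?g z) _ =>
         notypeclasses refine (@der_add _ f g _ _ _ _ _); der_rec
  | |- is_derive _ _ (fun z => - @?f z) _ =>
         notypeclasses refine (@der_opp _ f _ _ _); der_rec
  | |- is_derive _ _ (fun z => @?f z * @?g z) _ =>
         notypeclasses refine (@der_mul _ f g _ _ _ _ _); der_rec
  | |- is_derive _ _ (fun z => @?f z ^+ 2) _ =>
         notypeclasses refine (@der_sqr _ f _ _ _); der_rec
  | |- is_derive _ _ (fun z => (@?f z)^-1) _ =>
         notypeclasses refine (@der_inv _ f _ _ _ _); [|der_rec]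
  | |- is_derive _ _ _ _ => eassumption
  | _ => idtac
  end.
Ltac der :=
  notypeclasses refine (@is_derive_eq _ _ _ _ _ _ _ _ _ _);
  [der_rec | cbv beta ..].

Ltac cts := lazymatch goal with
  | |- continuous (fun _ => ?c) => exact: cts_cst
  | |- continuous (fun z => @?f z + @?g z) => apply: (@cts_add _ f g); cts
  | |- continuous (fun z => - @?f z) => apply: (@cts_opp _ f); cts
  | |- continuous (fun z => @?f z * @?g z) => apply: (@cts_mul _ f g); cts
  | |- continuous (fun z => @?f z ^+ 2) => apply: (@cts_sqr _ f); cts
  | |- _ => assumption
  end.

(** * Integration over one period *)

Section Circle.
Variable R : realType.
Implicit Types f g : R -> R.

Definition circ_int g := \int[@lebesgue_measure R]_(t in `[0, pi *+ 2]) g t.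

Let pi2_gt0 : 0 < pi *+ 2 :> R. Proof. by rewrite pmulrn_lgt0 ?pi_gt0. Qed.

Lemma integrable_circ g : continuous g ->
  (@lebesgue_measure R).-integrable `[0, pi *+ 2] (EFin \o g).
Proof.
move=> gc; apply: continuous_compact_integrable; first exact: segment_compact.
exact: continuous_subspaceT.
Qed.

Lemma circ_int_cst (r : R) : circ_int (fun=> r) = pi *+ 2 * r.
Proof.
rewrite /circ_int Rintegral_cst //= mulrC; congr (_ * _).
by rewrite lebesgue_measure_itv /= lte_fin pi2_gt0 sube0.
Qed.

Lemma circ_intN g : continuous g -> circ_int (fun t => - g t) = - circ_int g.
Proof.
move=> gc; rewrite /circ_int -mulN1r -RintegralZl //; last exact: integrable_circ.
by apply: eq_Rintegral => t _; rewrite mulN1r.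
Qed.

(** The form in which closedness of a curve is used: the integral of the
    derivative of a periodic function is zero. *)
Lemma circ_int_primitive g G : continuous g ->
  (forall t : R, is_derive t 1 G (g t)) -> G (pi *+ 2) = G 0 -> circ_int g = 0.
Proof.
move=> gc dG Gper; rewrite /circ_int /Rintegral.
have Gc : continuous G by move=> t; exact: is_derive1_continuous (dG t).
rewrite (@continuous_FTC2 _ g G) ?Gper ?subee //.
- exact: continuous_subspaceT.
- split=> [t _||]; first by case: (dG t).
  + by apply: cvg_at_right_filter; exact: Gc.
  + by apply: cvg_at_left_filter; exact: Gc.
- by move=> t _; rewrite derive1E; case: (dG t).
Qed.

Lemma circ_int_derive (f f' : R -> R -> R) (l r s M : R) : l < s < r ->
  (forall z, l < z < r -> continuous (f z)) ->
  (forall z t : R, l < z < r -> is_derive z 1 (f^~ t) (f' z t)) ->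
  (forall z t, l < z < r -> 0 <= t <= pi *+ 2 -> `|f' z t| <= M) ->
  is_derive s 1 (fun z => circ_int (f z)) (circ_int (f' s)).
Proof.
move=> slr fc fd fM.
have M0 : 0 <= M.
  by apply: le_trans (fM s 0 slr _); rewrite ?normr_ge0 // lexx ltW.
have Is : `]l, r[%classic s by rewrite /= in_itv.
have If z : `]l, r[%classic z ->
    (@lebesgue_measure R).-integrable `[0, pi *+ 2] (EFin \o f z).
  by rewrite /= in_itv /= => /fc; exact: integrable_circ.
have df z t : `]l, r[%classic z -> `[0, pi *+ 2]%classic t -> derivable (f^~ t) z 1.
  by rewrite /= in_itv /= => /fd fz _; case: (fz t).
have fG z t : `]l, r[%classic z -> `[0, pi *+ 2]%classic t ->
    `|lebesgue_integral_under.partial1of2 f z t| <= M.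
  rewrite lebesgue_integral_under.partial1of2E /= !in_itv /= => zlr t0.
  by case: (fd z t zlr) => _ ->; exact: fM.
have MI : (@lebesgue_measure R).-integrable `[0, pi *+ 2] (EFin \o (fun=> M)).
  by apply: integrable_circ; exact: cst_continuous.
split.
  exact: (derivable_under_integral _ Is If df (fun=> M0) MI fG).
rewrite -derive1E (differentiation_under_integral _ Is If df (fun=> M0) MI fG) //.
apply: eq_Rintegral => t _; rewrite lebesgue_integral_under.partial1of2E.
by case: (fd s t slr).
Qed.

End Circle.

(** * The Cauchy kernel of a circle

    The circle is gamma(t) = rho (cos t + i sin t), so that gamma' = i gamma,
    and the kernel is evaluated at the points w = s (d1 + i d2) of a line
    through the centre, with d1 + i d2 of modulus 1 and |s| < rho / 2. *)

Section Kernel.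
Variables (R : realType) (rho d1 d2 : R).
Hypotheses (rho0 : 0 < rho) (d_unit : d1 ^+ 2 + d2 ^+ 2 = 1).
Implicit Types s t : R.

Definition circx t : R := rho * cos t.
Definition circy t : R := rho * sin t.
(** off is gamma(t) - w and recip is 1 / (gamma(t) - w). *)
Definition offx s t := circx t - s * d1.
Definition offy s t := circy t - s * d2.
Definition off2 s t := offx s t ^+ 2 + offy s t ^+ 2.
Definition recip_x s t := offx s t * (off2 s t)^-1.
Definition recip_y s t := - (offy s t * (off2 s t)^-1).

Lemma der_circx t : is_derive t 1 circx (- circy t).
Proof. rewrite /circx /circy; der; ring. Qed.
Lemma der_circy t : is_derive t 1 circy (circx t).
Proof. rewrite /circx /circy; der; ring. Qed.

(** |gamma - w| >= rho - |s| >= rho / 2, by the Cauchy-Schwarz inequality. *)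
Lemma off2_ge s t : `|s| < rho / 2 -> rho ^+ 2 / 4 <= off2 s t.
Proof.
move=> sr; have cs := cos2Dsin2 t.
(* Cauchy-Schwarz, as Lagrange's identity *)
have m1 : (cos t * d1 + sin t * d2) ^+ 2 <= 1.
  rewrite -[leRHS]mulr1 -{1}cs -d_unit -subr_ge0.
  rewrite [leRHS](_ : _ = (cos t * d2 - sin t * d1) ^+ 2); last ring.
  exact: sqr_ge0.
have sm : s * (cos t * d1 + sin t * d2) <= `|s|.
  apply: le_trans (ler_norm _) _; rewrite normrM ler_piMr //.
  by rewrite -(@ler_pXn2r _ 2) ?nnegrE // expr1n -normrX ger0_norm ?sqr_ge0.
have -> : off2 s t = rho ^+ 2 * (cos t ^+ 2 + sin t ^+ 2)
   - 2 * rho * (s * (cos t * d1 + sin t * d2)) + `|s| ^+ 2 * (d1 ^+ 2 + d2 ^+ 2).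
  rewrite -normrX [`|s ^+ 2|]ger0_norm ?sqr_ge0 //.
  by rewrite /off2 /offx /offy /circx /circy; ring.
rewrite cs d_unit !mulr1; have := ler_wpM2l (ltW rho0) sm.
have s0 := normr_ge0 s; set m := s * (_ + _); move: sm; rewrite -/m => sm sm'.
nra.
Qed.

Lemma off2_gt0 s t : `|s| < rho / 2 -> 0 < off2 s t.
Proof.
by move/off2_ge => /(_ t); apply: lt_le_trans; rewrite divr_gt0 ?exprn_gt0.
Qed.

Let recip_sqrE s t : `|s| < rho / 2 ->
  recip_x s t ^+ 2 + recip_y s t ^+ 2 = (off2 s t)^-1.
Proof.
move=> /off2_gt0-/(_ t) o0; rewrite /recip_x /recip_y /off2.
by rewrite /off2 in o0; field; apply: lt0r_neq0.
Qed.

(** With Z = 1 / (gamma - w), the derivative of Z in s is d Z ^ 2, and its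
    derivative in t is - gamma' Z ^ 2.  The next four lemmas give the real and
    imaginary parts; all later derivatives are polynomial in those of Z. *)
Lemma der_recip_x s t : `|s| < rho / 2 -> is_derive s 1 (recip_x^~ t)
  (d1 * (recip_x s t ^+ 2 - recip_y s t ^+ 2) - d2 * (2 * recip_x s t * recip_y s t)).
Proof.
move=> /off2_gt0-/(_ t) o0; have n0 := lt0r_neq0 o0; move: n0.
rewrite /recip_x /recip_y /off2 /offx /offy => n0; der => //; by field.
Qed.

Lemma der_recip_y s t : `|s| < rho / 2 -> is_derive s 1 (recip_y^~ t)
  (d2 * (recip_x s t ^+ 2 - recip_y s t ^+ 2) + d1 * (2 * recip_x s t * recip_y s t)).
Proof.
move=> /off2_gt0-/(_ t) o0; have n0 := lt0r_neq0 o0; move: n0.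
rewrite /recip_x /recip_y /off2 /offx /offy => n0; der => //; by field.
Qed.

Lemma der_recip_x_circ s t : `|s| < rho / 2 -> is_derive t 1 (recip_x s)
  (circy t * (recip_x s t ^+ 2 - recip_y s t ^+ 2) + circx t * (2 * recip_x s t * recip_y s t)).
Proof.
move=> /off2_gt0-/(_ t) o0; have n0 := lt0r_neq0 o0; move: n0.
have dx := der_circx t; have dy := der_circy t.
rewrite /recip_x /recip_y /off2 /offx /offy => n0; der => //; by field.
Qed.

Lemma der_recip_y_circ s t : `|s| < rho / 2 -> is_derive t 1 (recip_y s)
  (circy t * (2 * recip_x s t * recip_y s t) - circx t * (recip_x s t ^+ 2 - recip_y s t ^+ 2)).
Proof.
move=> /off2_gt0-/(_ t) o0; have n0 := lt0r_neq0 o0; move: n0.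
have dx := der_circx t; have dy := der_circy t.
rewrite /recip_x /recip_y /off2 /offx /offy => n0; der => //; by field.
Qed.

Lemma continuous_recip_x s : `|s| < rho / 2 -> continuous (recip_x s).
Proof. by move=> sr t; exact: is_derive1_continuous (der_recip_x_circ t sr). Qed.

Lemma continuous_recip_y s : `|s| < rho / 2 -> continuous (recip_y s).
Proof. by move=> sr t; exact: is_derive1_continuous (der_recip_y_circ t sr). Qed.

(** The domination hypothesis of differentiation under the integral sign.  It
    is stable under the ring operations, so that it holds for polynomials in
    the two parts of the kernel and in continuous functions of t. *)
Definition bounded_strip (f : R -> R -> R) := exists M, forall s t,
  `|s| < rho / 2 -> 0 <= t <= pi *+ 2 -> `|f s t| <= M.

Lemma bounded_stripD f g : bounded_strip f -> bounded_strip g ->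
  bounded_strip (fun s t => f s t + g s t).
Proof.
move=> [M fM] [L gL]; exists (M + L) => s t sr tr.
by rewrite (le_trans (ler_normD _ _)) // lerD ?fM ?gL.
Qed.

Lemma bounded_stripN f : bounded_strip f -> bounded_strip (fun s t => - f s t).
Proof. by move=> [M fM]; exists M => s t sr tr; rewrite normrN fM. Qed.

Lemma bounded_stripM f g : bounded_strip f -> bounded_strip g ->
  bounded_strip (fun s t => f s t * g s t).
Proof.
by move=> [M fM] [L gL]; exists (M * L) => s t sr tr; rewrite normrM ler_pM ?fM ?gL.
Qed.

Lemma bounded_stripX f : bounded_strip f -> bounded_strip (fun s t => f s t ^+ 2).
Proof. by move=> fM; exact: bounded_stripM. Qed.

Lemma bounded_strip_cst (r : R) : bounded_strip (fun _ _ => r).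
Proof. by exists `|r|. Qed.

Lemma bounded_strip_continuous (p : R -> R) : continuous p ->
  bounded_strip (fun _ t => p t).
Proof.
move=> pc; have pc' : {within `[0, pi *+ 2], continuous (fun t => `|p t|)}.
  by apply: continuous_subspaceT => t; apply: continuous_comp (pc t) _;
    exact: norm_continuous.
have pi0 : 0 <= pi *+ 2 :> R by rewrite mulrn_wge0 // pi_ge0.
have [c _ cM] := EVT_max pi0 pc'.
by exists `|p c| => s t _ tr; apply: cM; rewrite in_itv.
Qed.

Let recip_sqr_le s t : `|s| < rho / 2 ->
  recip_x s t ^+ 2 + recip_y s t ^+ 2 <= (rho ^+ 2 / 4)^-1.
Proof.
move=> sr; rewrite recip_sqrE // lef_pV2 ?posrE ?off2_ge ?off2_gt0 //.
by rewrite divr_gt0 ?exprn_gt0.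
Qed.

Let normr_le1D (x y : R) : x ^+ 2 <= y -> `|x| <= 1 + y.
Proof.
move=> xy; have [x0|x0] := leP 0 x; [rewrite ger0_norm //|rewrite ltr0_norm //];
  have := sqr_ge0 (x - 1); have := sqr_ge0 (x + 1); nra.
Qed.

Lemma bounded_recip_x : bounded_strip recip_x.
Proof.
exists (1 + (rho ^+ 2 / 4)^-1) => s t sr _; apply: normr_le1D.
by apply: le_trans (recip_sqr_le t sr); rewrite lerDl sqr_ge0.
Qed.

Lemma bounded_recip_y : bounded_strip recip_y.
Proof.
exists (1 + (rho ^+ 2 / 4)^-1) => s t sr _; apply: normr_le1D.
by apply: le_trans (recip_sqr_le t sr); rewrite lerDr sqr_ge0.
Qed.

Lemma strip_int_derive (f f' : R -> R -> R) s :
  (forall s, `|s| < rho / 2 -> continuous (f s)) ->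
  (forall s t, `|s| < rho / 2 -> is_derive s 1 (f^~ t) (f' s t)) ->
  bounded_strip f' -> `|s| < rho / 2 ->
  is_derive s 1 (fun s => circ_int (f s)) (circ_int (f' s)).
Proof.
move=> fc fd [M fM] sr; have E z : (- (rho / 2) < z < rho / 2) = (`|z| < rho / 2).
  by rewrite ltr_norml.
apply: (@circ_int_derive _ f f' (- (rho / 2)) (rho / 2) s M); first by rewrite E.
- by move=> z; rewrite E; exact: fc.
- by move=> z t; rewrite E; exact: fd.
- by move=> z t; rewrite E; exact: fM.
Qed.

End Kernel.

Ltac bnd := repeat first [exact: bounded_recip_x | exact: bounded_recip_y
  | exact: bounded_strip_cst | apply: bounded_strip_continuous; assumption
  | apply: bounded_stripD | apply: bounded_stripN | apply: bounded_stripX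
  | apply: bounded_stripM].

(** * Differentiation of Cauchy integrals *)

Section Transform.
Variables (R : realType) (rho d1 d2 : R) (p q : R -> R).
Hypotheses (rho0 : 0 < rho) (d_unit : d1 ^+ 2 + d2 ^+ 2 = 1).
Hypotheses (pc : continuous p) (qc : continuous q).
Implicit Types s t : R.
Local Notation X := (recip_x rho d1 d2).
Local Notation Y := (recip_y rho d1 d2).

(** With P = p + i q, Z = 1 / (gamma - w) and d = d1 + i d2, the next three are
    the real parts of P Z and of its first two derivatives in s, which are
    P d Z ^ 2 and 2 P d ^ 2 Z ^ 3. *)
Definition cauchy_integrand s t := p t * X s t - q t * Y s t.

Definition cauchy_integrand1 s t :=
  p t * (d1 * (X s t ^+ 2 - Y s t ^+ 2) - d2 * (2 * X s t * Y s t)) -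
  q t * (d2 * (X s t ^+ 2 - Y s t ^+ 2) + d1 * (2 * X s t * Y s t)).

Definition cauchy_integrand2 s t :=
  p t * (2 * ((d1 ^+ 2 - d2 ^+ 2) * (X s t * (X s t ^+ 2 - 3 * Y s t ^+ 2)) -
              (2 * d1 * d2) * (Y s t * (3 * X s t ^+ 2 - Y s t ^+ 2)))) -
  q t * (2 * ((d1 ^+ 2 - d2 ^+ 2) * (Y s t * (3 * X s t ^+ 2 - Y s t ^+ 2)) +
              (2 * d1 * d2) * (X s t * (X s t ^+ 2 - 3 * Y s t ^+ 2)))).

Lemma continuous_cauchy s : `|s| < rho / 2 -> continuous (cauchy_integrand s).
Proof.
move=> sr; have Xc := continuous_recip_x rho0 d_unit sr.
by have Yc := continuous_recip_y rho0 d_unit sr; rewrite /cauchy_integrand; cts.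
Qed.

Lemma continuous_cauchy1 s : `|s| < rho / 2 -> continuous (cauchy_integrand1 s).
Proof.
move=> sr; have Xc := continuous_recip_x rho0 d_unit sr.
by have Yc := continuous_recip_y rho0 d_unit sr; rewrite /cauchy_integrand1; cts.
Qed.

Lemma continuous_cauchy2 s : `|s| < rho / 2 -> continuous (cauchy_integrand2 s).
Proof.
move=> sr; have Xc := continuous_recip_x rho0 d_unit sr.
by have Yc := continuous_recip_y rho0 d_unit sr; rewrite /cauchy_integrand2; cts.
Qed.

Lemma der_cauchy s : `|s| < rho / 2 ->
  is_derive s 1 (fun s => circ_int (cauchy_integrand s)) (circ_int (cauchy_integrand1 s)).
Proof.
apply: strip_int_derive => [|{}s t sr|]; first exact: continuous_cauchy.
- have dx := der_recip_x rho0 d_unit t sr; have dy := der_recip_y rho0 d_unit t sr.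
  by rewrite /cauchy_integrand /cauchy_integrand1; der; ring.
- by rewrite /cauchy_integrand1; bnd.
Qed.

Lemma der_cauchy1 s : `|s| < rho / 2 ->
  is_derive s 1 (fun s => circ_int (cauchy_integrand1 s)) (circ_int (cauchy_integrand2 s)).
Proof.
apply: strip_int_derive => [|{}s t sr|]; first exact: continuous_cauchy1.
- have dx := der_recip_x rho0 d_unit t sr; have dy := der_recip_y rho0 d_unit t sr.
  by rewrite /cauchy_integrand1 /cauchy_integrand2; der; ring.
- by rewrite /cauchy_integrand2; bnd.
Qed.

End Transform.

(** * Cauchy's integral formula for C^1 functions *)

Section CauchyFormula.
Variables (R : realType) (rho d1 d2 : R).
Hypotheses (rho0 : 0 < rho) (d_unit : d1 ^+ 2 + d2 ^+ 2 = 1).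
Implicit Types s t : R.
Local Notation gx := (circx rho).
Local Notation gy := (circy rho).
Local Notation X := (recip_x rho d1 d2).
Local Notation Y := (recip_y rho d1 d2).

Lemma continuous_circx : continuous gx.
Proof. by move=> t; exact: is_derive1_continuous (der_circx rho t). Qed.

Lemma continuous_circy : continuous gy.
Proof. by move=> t; exact: is_derive1_continuous (der_circy rho t). Qed.

(** The integral of c gamma' / (gamma - w) is 2 i pi c, for c = c1 + i c2; this
    is its real part.  At w = 0 the integrand is the constant i c.  The integral
    does not depend on w since its derivative in s is the integral of
    c d gamma' Z ^ 2, the derivative in t of the periodic function - c d Z. *)
Lemma circ_int_kernel (c1 c2 : R) s : `|s| < rho / 2 ->
  circ_int (cauchy_integrand rho d1 d2 (fun t => - (c1 * gy t) - c2 * gx t)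
                             (fun t => - (c2 * gy t) + c1 * gx t) s) =
  - (pi *+ 2 * c2).
Proof.
have gxc := continuous_circx; have gyc := continuous_circy.
set p := fun t => _; set q := fun t => _.
have pc : continuous p by rewrite /p; cts.
have qc : continuous q by rewrite /q; cts.
have r2 : 0 < rho / 2 by rewrite divr_gt0.
have at0 : circ_int (cauchy_integrand rho d1 d2 p q 0) = - (pi *+ 2 * c2).
  rewrite -mulrN -circ_int_cst; congr (circ_int _); apply/funext => t.
  have cs := cos2Dsin2 t.
  rewrite /cauchy_integrand /p /q /recip_x /recip_y /off2 /offx /offy /circx /circy.
  rewrite !mul0r !subr0 !exprMn -mulrDr cs mulr1.
  transitivity (- c2 * (cos t ^+ 2 + sin t ^+ 2)); last by rewrite cs mulr1.
  by field; apply: lt0r_neq0.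
have d0 z : `|z| < rho / 2 -> circ_int (cauchy_integrand1 rho d1 d2 p q z) = 0.
  move=> zr; pose G t := (c2 * d1 + c1 * d2) * Y z t - (c1 * d1 - c2 * d2) * X z t.
  apply: (@circ_int_primitive R (cauchy_integrand1 rho d1 d2 p q z) G).
  - exact: (continuous_cauchy1 rho0 d_unit pc qc zr).
  - move=> t; have dx := der_recip_x_circ rho0 d_unit t zr.
    have dy := der_recip_y_circ rho0 d_unit t zr.
    by rewrite /G; der; rewrite /cauchy_integrand1 /p /q; ring.
  - rewrite /G /recip_x /recip_y /off2 /offx /offy /circx /circy.
    by rewrite cos2pi sin2pi cos0 sin0.
have dd (z : R) : `|z| < rho / 2 ->
    is_derive z 1 (fun s => circ_int (cauchy_integrand rho d1 d2 p q s)) 0.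
  by move=> zr; rewrite -(d0 z zr); exact: der_cauchy.
move=> sr; rewrite -at0; pose f s := circ_int (cauchy_integrand rho d1 d2 p q s).
rewrite -/(f s) -/(f 0); rewrite -/f in dd.
move: sr; rewrite ltr_norml => /andP[sr1 sr2].
have [s0|/ltW s0] := leP 0 s; [|apply: esym];
 (apply: derive0_segment => // z /andP[z1 z2]; have [|//] := dd z;
  rewrite ltr_norml; apply/andP; split; lra).
Qed.

(** F = u + i v satisfies the Cauchy-Riemann equations with F' = a + i b.  The
    square of half-side 4 rho contains the points w + l (gamma - w) for
    |w| < rho / 2 and -1 < l < 2, an open set of l that contains [0, 1]. *)
Variables (u v a b : R -> R -> R) (M : R).
Hypothesis du : forall x y : R, `|x| < 4 * rho -> `|y| < 4 * rho ->
  is_derive x 1 (u^~ y) (a x y) /\ is_derive y 1 (u x) (- b x y).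
Hypothesis dv : forall x y : R, `|x| < 4 * rho -> `|y| < 4 * rho ->
  is_derive x 1 (v^~ y) (b x y) /\ is_derive y 1 (v x) (a x y).
Hypothesis ac : forall x y : R, `|x| < 4 * rho -> `|y| < 4 * rho ->
  {for (x, y), continuous (fun z : R * R => a z.1 z.2)}.
Hypothesis bc : forall x y : R, `|x| < 4 * rho -> `|y| < 4 * rho ->
  {for (x, y), continuous (fun z : R * R => b z.1 z.2)}.
Hypothesis aM : forall x y : R, `|x| < 4 * rho -> `|y| < 4 * rho -> `|a x y| <= M.
Hypothesis bM : forall x y : R, `|x| < 4 * rho -> `|y| < 4 * rho -> `|b x y| <= M.

Let box (x y : R) : `|x| < 4 * rho -> `|y| < 4 * rho -> exists2 e, 0 < e &
  forall x' y', `|x' - x| < e -> `|y' - y| < e ->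
    `|x'| < 4 * rho /\ `|y'| < 4 * rho.
Proof.
move=> xr yr; exists (Num.min (4 * rho - `|x|) (4 * rho - `|y|)).
  by rewrite lt_min !subr_gt0 xr.
move=> x' y'; rewrite !lt_min => /andP[x1 _] /andP[_ y1]; split.
  by rewrite -(subrK x x') (le_lt_trans (ler_normD _ _)) // -ltrBrDr.
by rewrite -(subrK y y') (le_lt_trans (ler_normD _ _)) // -ltrBrDr.
Qed.

Lemma der_u_curve (c1 c2 : R -> R) (t e1 e2 : R) :
  `|c1 t| < 4 * rho -> `|c2 t| < 4 * rho ->
  is_derive t 1 c1 e1 -> is_derive t 1 c2 e2 ->
  is_derive t 1 (fun s => u (c1 s) (c2 s))
    (a (c1 t) (c2 t) * e1 - b (c1 t) (c2 t) * e2).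
Proof.
move=> h1 h2 dc1 dc2; have [e e0 bx] := box h1 h2.
apply: (is_derive_eq (@is_derive_curve _ u a (fun x y => - b x y)
  c1 c2 t _ _ e e0 _ (ac h1 h2) _ dc1 dc2)); last by rewrite mulNr.
  by move=> x y x1 y1; have [] := bx _ _ x1 y1; exact: du.
by apply: continuousN; exact: bc.
Qed.

Lemma der_v_curve (c1 c2 : R -> R) (t e1 e2 : R) :
  `|c1 t| < 4 * rho -> `|c2 t| < 4 * rho ->
  is_derive t 1 c1 e1 -> is_derive t 1 c2 e2 ->
  is_derive t 1 (fun s => v (c1 s) (c2 s))
    (b (c1 t) (c2 t) * e1 + a (c1 t) (c2 t) * e2).
Proof.
move=> h1 h2 dc1 dc2; have [e e0 bx] := box h1 h2.
apply: (@is_derive_curve _ v b a c1 c2 t _ _ e e0 _ (bc h1 h2) (ac h1 h2) dc1 dc2).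
by move=> x y x1 y1; have [] := bx _ _ x1 y1; exact: dv.
Qed.

(** The coordinates of w + l (gamma(t) - w). *)
Definition scaled_x s l t := s * d1 + l * offx rho d1 s t.
Definition scaled_y s l t := s * d2 + l * offy rho d2 s t.

Lemma normr_circx t : `|gx t| <= rho.
Proof.
by rewrite /circx normrM gtr0_norm // ler_piMr ?(ltW rho0) // cos_max.
Qed.

Lemma normr_circy t : `|gy t| <= rho.
Proof.
by rewrite /circy normrM gtr0_norm // ler_piMr ?(ltW rho0) // sin_max.
Qed.

Let norm_d (x y : R) : x ^+ 2 + y ^+ 2 = 1 -> `|x| <= 1.
Proof.
move=> xy; rewrite -(@ler_pXn2r _ 2) ?nnegrE // expr1n -normrX.
by rewrite ger0_norm ?sqr_ge0 // -xy lerDl sqr_ge0.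
Qed.

Let scaled_bound (d g s l : R) : `|d| <= 1 -> `|g| <= rho -> `|s| < rho / 2 ->
  -1 < l < 2 -> `|s * d + l * (g - s * d)| < 4 * rho.
Proof.
move=> h1 hg sr lr; have sd : `|s * d| <= rho / 2.
  by apply: le_trans (ltW sr); rewrite normrM ler_piMr.
have l2 : `|l| <= 2 by rewrite ler_norml; lra.
have gs : `|g - s * d| <= rho * (3 / 2).
  apply: le_trans (ler_normB _ _) _; lra.
have : `|l * (g - s * d)| <= 2 * (rho * (3 / 2)) by rewrite normrM ler_pM.
have := ler_normD (s * d) (l * (g - s * d)); have := rho0.
lra.
Qed.

Lemma scaled_x_bound s l t : `|s| < rho / 2 -> -1 < l < 2 ->
  `|scaled_x s l t| < 4 * rho.
Proof. by move=> sr lr; apply: scaled_bound => //; [exact: norm_d d_unit|exact: normr_circx]. Qed.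

Lemma scaled_y_bound s l t : `|s| < rho / 2 -> -1 < l < 2 ->
  `|scaled_y s l t| < 4 * rho.
Proof.
move=> sr lr; apply: scaled_bound => //; last exact: normr_circy.
by apply: norm_d; rewrite addrC; exact: d_unit.
Qed.

Lemma der_scaled_x s l t : is_derive t 1 (scaled_x s l) (- (l * gy t)).
Proof. have dx := der_circx rho t; rewrite /scaled_x /offx; der; ring. Qed.

Lemma der_scaled_y s l t : is_derive t 1 (scaled_y s l) (l * gx t).
Proof. have dx := der_circy rho t; rewrite /scaled_y /offy; der; ring. Qed.

(** With z = w + l (gamma - w), scaled_re and scaled_im are the two parts of
    F(z) gamma', and scaled_derive is the real part of F'(z) gamma'. *)
Definition scaled_re s l t :=
  - (u (scaled_x s l t) (scaled_y s l t) * gy t) - v (scaled_x s l t) (scaled_y s l t) * gx t.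
Definition scaled_im s l t :=
  - (v (scaled_x s l t) (scaled_y s l t) * gy t) + u (scaled_x s l t) (scaled_y s l t) * gx t.
Definition scaled_derive s l t :=
  - (a (scaled_x s l t) (scaled_y s l t) * gy t) - b (scaled_x s l t) (scaled_y s l t) * gx t.

Section Homotopy.
Variable s : R.
Hypothesis sr : `|s| < rho / 2.

Lemma continuous_scaled_u l : -1 < l < 2 ->
  continuous (fun t => u (scaled_x s l t) (scaled_y s l t)).
Proof.
move=> lr t; apply: is_derive1_continuous
  (der_u_curve _ _ (der_scaled_x s l t) (der_scaled_y s l t)).
  exact: scaled_x_bound.
exact: scaled_y_bound.
Qed.

Lemma continuous_scaled_v l : -1 < l < 2 ->
  continuous (fun t => v (scaled_x s l t) (scaled_y s l t)).
Proof.
move=> lr t; apply: is_derive1_continuous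
  (der_v_curve _ _ (der_scaled_x s l t) (der_scaled_y s l t)).
  exact: scaled_x_bound.
exact: scaled_y_bound.
Qed.

Lemma continuous_scaled_re l : -1 < l < 2 -> continuous (scaled_re s l).
Proof.
move=> lr; have gxc := continuous_circx; have gyc := continuous_circy.
have uc := continuous_scaled_u lr; have vc := continuous_scaled_v lr.
by rewrite /scaled_re; cts.
Qed.

Lemma continuous_scaled_im l : -1 < l < 2 -> continuous (scaled_im s l).
Proof.
move=> lr; have gxc := continuous_circx; have gyc := continuous_circy.
have uc := continuous_scaled_u lr; have vc := continuous_scaled_v lr.
by rewrite /scaled_im; cts.
Qed.

Lemma continuous_scaled_derive l : -1 < l < 2 -> continuous (scaled_derive s l).
Proof.
move=> lr; have gxc := continuous_circx; have gyc := continuous_circy.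
have cc t : (scaled_x s l x, scaled_y s l x) @[x --> t] --> (scaled_x s l t, scaled_y s l t).
  apply: (cvg_pair (is_derive1_continuous (der_scaled_x s l t))
                   (is_derive1_continuous (der_scaled_y s l t))).
have c1 : continuous (fun t => a (scaled_x s l t) (scaled_y s l t)).
  move=> t; have h1 := scaled_x_bound t sr lr; have h2 := scaled_y_bound t sr lr.
  exact: cvg_comp (cc t) (ac h1 h2).
have c2 : continuous (fun t => b (scaled_x s l t) (scaled_y s l t)).
  move=> t; have h1 := scaled_x_bound t sr lr; have h2 := scaled_y_bound t sr lr.
  exact: cvg_comp (cc t) (bc h1 h2).
by rewrite /scaled_derive; cts.
Qed.

(** F'(z) gamma' is 1 / l times the derivative in t of F(z). *)
Lemma circ_int_scaled_derive l : 0 < l < 2 -> circ_int (scaled_derive s l) = 0.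
Proof.
move=> /andP[l0 l2]; have lr : -1 < l < 2 by rewrite l2 (lt_trans _ l0) // ltrN10.
pose G t := l^-1 * u (scaled_x s l t) (scaled_y s l t).
apply: (@circ_int_primitive R (scaled_derive s l) G); first exact: continuous_scaled_derive.
  move=> t; have du' := der_u_curve (scaled_x_bound t sr lr) (scaled_y_bound t sr lr)
    (der_scaled_x s l t) (der_scaled_y s l t).
  by rewrite /G; der; rewrite /scaled_derive; field; exact: lt0r_neq0.
by rewrite /G /scaled_x /scaled_y /offx /offy /circx /circy cos2pi sin2pi cos0 sin0.
Qed.

(** The derivative in l of F(z) is F'(z) (gamma - w), and the factor gamma - w
    cancels the denominator of the kernel. *)
Lemma der_scaled (l t : R) : -1 < l < 2 ->
  is_derive l 1
    (fun l => cauchy_integrand rho d1 d2 (scaled_re s l) (scaled_im s l) s t)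
    (scaled_derive s l t).
Proof.
move=> lr; have n0 := lt0r_neq0 (off2_gt0 rho0 d_unit t sr).
have dx : is_derive l 1 (fun l => scaled_x s l t) (offx rho d1 s t).
  by rewrite /scaled_x; der; ring.
have dy : is_derive l 1 (fun l => scaled_y s l t) (offy rho d2 s t).
  by rewrite /scaled_y; der; ring.
have du' := @der_u_curve (scaled_x s ^~ t) (scaled_y s ^~ t) l _ _
  (scaled_x_bound t sr lr) (scaled_y_bound t sr lr) dx dy.
have dv' := @der_v_curve (scaled_x s ^~ t) (scaled_y s ^~ t) l _ _
  (scaled_x_bound t sr lr) (scaled_y_bound t sr lr) dx dy.
rewrite /cauchy_integrand /scaled_re /scaled_im; der.
rewrite /scaled_derive.
by rewrite /recip_x /recip_y; move: n0; rewrite /off2 => n0; field.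
Qed.

(** The real part of the formula, which is the one that isolates v. *)
Lemma cauchy_formula :
  circ_int (cauchy_integrand rho d1 d2 (scaled_re 0 1) (scaled_im 0 1) s) =
  - (pi *+ 2 * v (s * d1) (s * d2)).
Proof.
pose f l := circ_int (cauchy_integrand rho d1 d2 (scaled_re s l) (scaled_im s l) s).
have df (l : R) : -1 < l < 2 -> is_derive l 1 f (circ_int (scaled_derive s l)).
  move=> lr.
  apply: (@circ_int_derive _
    (fun l => cauchy_integrand rho d1 d2 (scaled_re s l) (scaled_im s l) s)
    (scaled_derive s) (-1) 2 l (M * rho + M * rho)) => // [z zr|z t zr|z t zr _].
  - by apply: continuous_cauchy; [| |exact: continuous_scaled_re|exact: continuous_scaled_im|].
  - exact: der_scaled.
  - rewrite /scaled_derive (le_trans (ler_normB _ _)) // normrN (normrM (a _ _)) (normrM (b _ _)).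
    have h1 := scaled_x_bound t sr zr; have h2 := scaled_y_bound t sr zr.
    by apply: lerD; apply: ler_pM; rewrite ?normr_ge0 ?aM ?bM ?normr_circx ?normr_circy //.
transitivity (f 1).
  rewrite /f; congr (circ_int _); apply/funext => t.
  have ex : scaled_x s 1 t = scaled_x 0 1 t by rewrite /scaled_x /offx; ring.
  have ey : scaled_y s 1 t = scaled_y 0 1 t by rewrite /scaled_y /offy; ring.
  by rewrite /cauchy_integrand /scaled_re /scaled_im ex ey.
transitivity (f 0).
  apply: derive0_segment => // z /andP[z0 z1].
    by have [|//] := df z; lra.
  have [|_ ->] := df z; first by lra.
  by apply: circ_int_scaled_derive; lra.
rewrite -(circ_int_kernel (u (s * d1) (s * d2)) _ sr) /f.
congr (circ_int _); apply/funext => t.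
by rewrite /cauchy_integrand /scaled_re /scaled_im /scaled_x /scaled_y !mul0r !addr0.
Qed.
End Homotopy.

(** The function below is the derivative in the direction d of v, which by the
    Cauchy formula is a Cauchy integral differentiated once; so it can be
    differentiated once more. *)
Lemma der_directional : is_derive (0 : R) 1
  (fun s : R => b (s * d1) (s * d2) * d1 + a (s * d1) (s * d2) * d2)
  (- (pi *+ 2)^-1 * circ_int (cauchy_integrand2 rho d1 d2 (scaled_re 0 1) (scaled_im 0 1) 0)).
Proof.
have pi0 : pi *+ 2 != 0 :> R by rewrite mulrn_eq0 /= lt0r_neq0 ?pi_gt0.
have r2 : 0 < rho / 2 by rewrite divr_gt0.
have z0 : `|0 : R| < rho / 2 by rewrite normr0.
have pc : continuous (scaled_re 0 1) by apply: continuous_scaled_re => //; lra.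
have qc : continuous (scaled_im 0 1) by apply: continuous_scaled_im => //; lra.
have near_s (s : R) : `|s| < rho / 2 -> \forall z \near s, `|z| < rho / 2.
  have E (z : R) : (`|z| < rho / 2) = (z \in `]- (rho / 2), (rho / 2)[).
    by rewrite in_itv ltr_norml.
  by rewrite E => /near_in_itvoo sr; near=> z; rewrite E; near: z.
have dV (s : R) : `|s| < rho / 2 -> is_derive s 1 (fun s => v (s * d1) (s * d2))
    (- (pi *+ 2)^-1 * circ_int (cauchy_integrand1 rho d1 d2 (scaled_re 0 1) (scaled_im 0 1) s)).
  move=> sr; have dc := der_cauchy rho0 d_unit pc qc sr.
  apply: (near_eq_is_derive (f := fun s => - (pi *+ 2)^-1 *
    circ_int (cauchy_integrand rho d1 d2 (scaled_re 0 1) (scaled_im 0 1) s))).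
    near=> z; rewrite cauchy_formula; last by near: z; exact: near_s.
    by rewrite mulrNN mulKf.
have dV' (s : R) : `|s| < rho / 2 -> is_derive s 1 (fun s => v (s * d1) (s * d2))
    (b (s * d1) (s * d2) * d1 + a (s * d1) (s * d2) * d2).
  move=> sr; have lr : -1 < (0 : R) < 2 by lra.
  have := scaled_x_bound 0 sr lr; have := scaled_y_bound 0 sr lr.
  rewrite /scaled_x /scaled_y !mul0r !addr0 => h2 h1.
  have dx : is_derive s 1 (fun s => s * d1) d1 by der; ring.
  have dy : is_derive s 1 (fun s => s * d2) d2 by der; ring.
  exact: (@der_v_curve (fun s => s * d1) (fun s => s * d2) s _ _ h1 h2 dx dy).
have dc := der_cauchy1 rho0 d_unit pc qc z0.
apply: (near_eq_is_derive (f := fun s => - (pi *+ 2)^-1 *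
    circ_int (cauchy_integrand1 rho d1 d2 (scaled_re 0 1) (scaled_im 0 1) s))).
  near=> z; have zr : `|z| < rho / 2 by near: z; exact: near_s.
  by case: (dV z zr) => _ <-; case: (dV' z zr) => _ ->.
Unshelve. all: by end_near. Qed.
End CauchyFormula.

(** * Harmonicity of C^1 solutions of the Cauchy-Riemann equations *)

Section Harmonic.
Variables (R : realType) (u v a b : R -> R -> R) (x0 y0 e : R).
Hypothesis e0 : 0 < e.
Hypothesis du : forall x y : R, `|x - x0| < e -> `|y - y0| < e ->
  is_derive x 1 (u^~ y) (a x y) /\ is_derive y 1 (u x) (- b x y).
Hypothesis dv : forall x y : R, `|x - x0| < e -> `|y - y0| < e ->
  is_derive x 1 (v^~ y) (b x y) /\ is_derive y 1 (v x) (a x y).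
Hypothesis ac : forall x y : R, `|x - x0| < e -> `|y - y0| < e ->
  {for (x, y), continuous (fun z : R * R => a z.1 z.2)}.
Hypothesis bc : forall x y : R, `|x - x0| < e -> `|y - y0| < e ->
  {for (x, y), continuous (fun z : R * R => b z.1 z.2)}.

Lemma near_bounded (f : R -> R -> R) : 
  {for (x0, y0), continuous (fun z : R * R => f z.1 z.2)} ->
  exists r, 0 < r /\ forall x y : R, `|x - x0| < r -> `|y - y0| < r ->
    `|f x y| <= 1 + `|f x0 y0|.
Proof.
move=> /cvgrPdistC_le/(_ 1 ltr01); case/nbhs_ballP => r /= r0 fr.
exists r; split=> // x y xr yr; have := fr (x, y); rewrite /= => h.
rewrite -[f x y](subrK (f x0 y0)) (le_trans (ler_normD _ _)) // lerD2r h //.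
by split; rewrite /ball /= distrC.
Qed.

(** The second derivatives of v exist in the directions 1 and i and are
    opposite, because they are Cauchy integrals whose integrands differ by the
    factor i ^ 2. *)
Lemma cauchy_riemann_harmonic : exists c,
  is_derive x0 1 (b^~ y0) c /\ is_derive y0 1 (a x0) (- c).
Proof.
have xx : `|x0 - x0| < e by rewrite subrr normr0.
have yy : `|y0 - y0| < e by rewrite subrr normr0.
have [r1 [r10 ra]] := near_bounded (ac xx yy).
have [r2 [r20 rb]] := near_bounded (bc xx yy).
(* The circle is chosen so small that F' is bounded on the square of
   half-side 4 rho. *)
pose rho := Num.min e (Num.min r1 r2) / 4.
have rho0 : 0 < rho by rewrite divr_gt0 // !lt_min e0 r10.
have rE (z : R) : `|z| < 4 * rho -> [/\ `|z| < e, `|z| < r1 & `|z| < r2].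
  have -> : 4 * rho = Num.min e (Num.min r1 r2) by rewrite /rho; field.
  by rewrite !lt_min => /andP[-> /andP[-> ->]].
pose M := Num.max (1 + `|a x0 y0|) (1 + `|b x0 y0|).
pose sh (f : R -> R -> R) x y := f (x + x0) (y + y0).
have sub (x z : R) : x + z - z = x by rewrite addrK.
have dsh1 (f : R -> R -> R) (x y l : R) : is_derive (x + x0) 1 (f^~ (y + y0)) l ->
    is_derive x 1 (sh f ^~ y) l.
  move=> df; apply: (is_derive_eq (@der_comp _ _ (fun z => z + x0) x l 1 df _));
    last by rewrite mulr1.
  by der; rewrite addr0.
have dsh2 (f : R -> R -> R) (x y l : R) : is_derive (y + y0) 1 (f (x + x0)) l ->
    is_derive y 1 (sh f x) l.
  move=> df; apply: (is_derive_eq (@der_comp _ _ (fun z => z + y0) y l 1 df _));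
    last by rewrite mulr1.
  by der; rewrite addr0.
have du' (x y : R) : `|x| < 4 * rho -> `|y| < 4 * rho ->
  is_derive x 1 (sh u^~ y) (sh a x y) /\ is_derive y 1 (sh u x) (- sh b x y).
  move=> /rE[x1 _ _] /rE[y1 _ _]; have [||h1 h2] := du (x := x + x0) (y := y + y0).
  - by rewrite sub.
  - by rewrite sub.
  by split; [apply: dsh1|apply: dsh2].
have dv' (x y : R) : `|x| < 4 * rho -> `|y| < 4 * rho ->
  is_derive x 1 (sh v^~ y) (sh b x y) /\ is_derive y 1 (sh v x) (sh a x y).
  move=> /rE[x1 _ _] /rE[y1 _ _]; have [||h1 h2] := dv (x := x + x0) (y := y + y0).
  - by rewrite sub.
  - by rewrite sub.
  by split; [apply: dsh1|apply: dsh2].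
have shc (x y : R) : (p.1 + x0, p.2 + y0) @[p --> (x, y)] --> (x + x0, y + y0).
  have c1 : p.1 + x0 @[p --> (x, y)] --> x + x0 by apply: cvgD; [exact: cvg_fst|exact: cvg_cst].
  have c2 : p.2 + y0 @[p --> (x, y)] --> y + y0 by apply: cvgD; [exact: cvg_snd|exact: cvg_cst].
  exact: cvg_pair c1 c2.
have ac' (x y : R) : `|x| < 4 * rho -> `|y| < 4 * rho ->
    {for (x, y), continuous (fun z : R * R => sh a z.1 z.2)}.
  move=> /rE[x1 _ _] /rE[y1 _ _]; rewrite -(sub x x0) in x1.
  by rewrite -(sub y y0) in y1; exact: cvg_comp (shc x y) (ac x1 y1).
have bc' (x y : R) : `|x| < 4 * rho -> `|y| < 4 * rho ->
    {for (x, y), continuous (fun z : R * R => sh b z.1 z.2)}.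
  move=> /rE[x1 _ _] /rE[y1 _ _]; rewrite -(sub x x0) in x1.
  by rewrite -(sub y y0) in y1; exact: cvg_comp (shc x y) (bc x1 y1).
have aM (x y : R) : `|x| < 4 * rho -> `|y| < 4 * rho -> `|sh a x y| <= M.
  by move=> /rE[_ x1 _] /rE[_ y1 _]; rewrite /M le_max ra ?sub.
have bM (x y : R) : `|x| < 4 * rho -> `|y| < 4 * rho -> `|sh b x y| <= M.
  by move=> /rE[_ _ x1] /rE[_ _ y1]; rewrite /M le_max rb ?sub ?orbT.
have d10 : 1 ^+ 2 + 0 ^+ 2 = 1 :> R by ring.
have d01 : 0 ^+ 2 + 1 ^+ 2 = 1 :> R by ring.
have D1 := der_directional rho0 d10 du' dv' ac' bc' aM bM.
have D2 := der_directional rho0 d01 du' dv' ac' bc' aM bM.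
set c1 := (X in is_derive _ _ _ X) in D1; set c2 := (X in is_derive _ _ _ X) in D2.
have c12 : c2 = - c1.
  rewrite /c1 /c2 -mulrN -circ_intN.
    congr (_ * circ_int _); apply/funext => t.
    rewrite /cauchy_integrand2 /scaled_re /scaled_im /scaled_x /scaled_y.
    by rewrite /recip_x /recip_y /off2 /offx /offy !mul0r !subr0; ring.
  have rh : `|0 : R| < rho / 2 by rewrite normr0 divr_gt0.
  have lr : -1 < (1 : R) < 2 by lra.
  apply: (continuous_cauchy2 rho0 d10 _ _ rh).
    exact: (continuous_scaled_re rho0 d10 du' dv' ac' bc' rh lr).
  exact: (continuous_scaled_im rho0 d10 du' dv' ac' bc' rh lr).
have unshift (f : R -> R) (z l : R) : is_derive (0 : R) 1 (fun s => f (s + z)) l ->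
    is_derive z 1 f l.
  move=> df; have -> : f = fun s => (fun s => f (s + z)) (s - z).
    by apply/funext => s; rewrite subrK.
  rewrite -(subrr z) in df; apply: (is_derive_eq (@der_comp _ (fun s => f (s + z))
    (fun s => s - z) z l 1 df _)); last by rewrite mulr1.
  by der; rewrite addr0.
rewrite c12 in D2; clear c12 c2; clearbody c1; exists c1; split.
  have D1' : is_derive (0 : R) 1 (fun s : R => b (s + x0) y0) c1.
    have -> : (fun s => b (s + x0) y0) = (fun s => sh b (s * 1) (s * 0) * 1 +
      sh a (s * 1) (s * 0) * 0); last exact: D1.
    by apply/funext => s; rewrite /sh !mulr1 !mulr0 add0r addr0.
  exact: (unshift (b^~ y0) x0 c1 D1').
have D2' : is_derive (0 : R) 1 (fun s : R => a x0 (s + y0)) (- c1).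
  have -> : (fun s => a x0 (s + y0)) = (fun s => sh b (s * 0) (s * 1) * 0 +
    sh a (s * 0) (s * 1) * 1); last exact: D2.
  by apply/funext => s; rewrite /sh !mulr1 !mulr0 !add0r.
exact: (unshift (a x0) y0 (- c1) D2').
Qed.
End Harmonic.

(** * Functions of a quaternion with vanishing laplacian *)

(** Directional derivatives are reduced to derivatives of one real variable. *)
Lemma is_derive_lineP (R : realType) (V W : normedModType R) (f : V -> W) (x v : V) (l : W) :
  is_derive x v f l <-> is_derive (0 : R) 1 (fun h : R => f (h *: v + x)) l.
Proof.
have E : 'D_v f x = 'D_1 (fun h : R => f (h *: v + x)) (0 : R).
  rewrite /derive; set g1 := fun h => _; set g2 := fun h => _.
  suff -> : g1 = g2 by [].
  by rewrite funeqE /g1 /g2 => h /=; rewrite addr0 scale0r add0r [h%:A]mulr1.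
split=> -[df <-]; (split; last by rewrite E).
  by move/(derivable1P f x v): df.
by apply/(derivable1P f x v).
Qed.

Section Directional.
Variables (R : realType) (V W : normedModType R).

Lemma is_deriveZl (f : V -> R) (x v : V) (l : R) (A : W) :
  is_derive x v f l -> is_derive x v (fun y => f y *: A) (l *: A).
Proof.
have S (g : R -> R) (a : R) : is_derive (0 : R) 1 g a ->
    is_derive (0 : R) 1 (fun y => g y *: A) (a *: A).
  case=> /derivable1_diffP dg <-.
  have dgA : differentiable (fun y => g y *: A) 0 by exact: differentiableZl.
  split; first exact: diff_derivable.
  by rewrite !deriveE // diffZl.
move=> df; apply/(is_derive_lineP (fun y => f y *: A) x v (l *: A)).2.
exact: S ((is_derive_lineP f x v l).1 df).
Qed.

Lemma is_derive_oppo (f : R -> W) (x : R) (l : W) :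
  is_derive x 1 f l -> is_derive (- x) 1 (fun t => f (- t)) (- l).
Proof.
move=> [/derivable1_diffP df <-].
have dm : is_derive x (- 1) f (- 'D_1 f x).
  by split; [exact: diff_derivable|rewrite !deriveE // linearN].
have dl := (is_derive_lineP f x (- 1) _).1 dm.
apply/(is_derive_lineP (fun t => f (- t)) (- x) 1 _).2.
rewrite (_ : (fun h : R => f (- (h *: (1 : R) - x))) = (fun h : R => f (h *: - (1 : R) + x))) //.
by apply/funext => h; rewrite opprB addrC scalerN.
Qed.

End Directional.


Section Harmonic4.
Variables (R : realType) (W : normedModType R).
Implicit Types (g : quat R -> W) (x : quat R).

(** The vanishing of the laplacian together with the existence of the iterated
    derivatives; the witnesses make it stable under finite sums and under
    equality near x. *)
Definition harmonic4 g x := exists (d1 : 'I_4 -> quat R -> W) (d2 : 'I_4 -> W),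
  [/\ forall i, \forall q \near x, is_derive q (qbase R i) g (d1 i q),
      forall i, is_derive x (qbase R i) (d1 i) (d2 i) & \sum_i d2 i = 0].

Lemma harmonic4_0 x : harmonic4 (fun=> 0) x.
Proof.
exists (fun _ _ => 0), (fun=> 0); split=> [i|i|]; last by rewrite big1.
  by near=> q; exact: is_derive_cst.
exact: is_derive_cst.
Unshelve. all: by end_near. Qed.

Lemma harmonic4_add g1 g2 x : harmonic4 g1 x -> harmonic4 g2 x ->
  harmonic4 (fun q => g1 q + g2 q) x.
Proof.
move=> [d1 [d2 [h1 h2 h3]]] [e1 [e2 [k1 k2 k3]]].
exists (fun i q => d1 i q + e1 i q), (fun i => d2 i + e2 i); split=> [i|i|].
- near=> q; have a1 : is_derive q (qbase R i) g1 (d1 i q) by near: q; exact: h1.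
  have a2 : is_derive q (qbase R i) g2 (e1 i q) by near: q; exact: k1.
  exact: (is_deriveD a1 a2).
- exact: (is_deriveD (h2 i) (k2 i)).
- by rewrite big_split /= h3 k3 addr0.
Unshelve. all: by end_near. Qed.

Lemma harmonic4_sum (I : Type) (r : seq I) (P : pred I) (G : I -> quat R -> W) x :
  (forall i, P i -> harmonic4 (G i) x) ->
  harmonic4 (fun q => \sum_(i <- r | P i) G i q) x.
Proof.
move=> GP; elim: r => [|i r IH].
  by under eq_fun do rewrite big_nil; exact: harmonic4_0.
case Pi: (P i); under eq_fun do rewrite big_cons Pi; last exact: IH.
by apply: harmonic4_add => //; exact: GP.
Qed.

Lemma harmonic4_near g1 g2 x : (\forall q \near x, g1 q = g2 q) ->
  harmonic4 g1 x -> harmonic4 g2 x.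
Proof.
move=> /near_join g12 [d1 [d2 [h1 h2 h3]]]; exists d1, d2; split=> // i.
near=> q; apply: (@near_eq_is_derive _ _ _ g1); first by near: q.
by near: q; exact: h1.
Unshelve. all: by end_near. Qed.

End Harmonic4.

Lemma harmonic4_scalel (R : realType) (W : normedModType R)
  (g : quat R -> R) (A : W) x : harmonic4 g x -> harmonic4 (fun q => g q *: A) x.
Proof.
move=> [d1 [d2 [h1 h2 h3]]].
exists (fun i q => d1 i q *: A), (fun i => d2 i *: A); split=> [i|i|].
- near=> q; have a1 : is_derive q (qbase R i) g (d1 i q) by near: q; exact: h1.
  exact: is_deriveZl.
- exact: is_deriveZl.
- by rewrite -scaler_suml h3 scale0r.
Unshelve. all: by end_near. Qed.

Lemma harmonic4_laplacian (R : realType) n (h : 'I_n) (g : 'rV[quat R]_n -> quat R) x :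
  harmonic4 (coord_map h g x) (x 0 h) ->
  laplacian_defined h g x /\ laplacian h g x = 0.
Proof.
move=> [d1 [d2 [h1 h2 h3]]].
have D i : is_derive (x 0 h) (qbase R i) ('D_(qbase R i) (coord_map h g x)) (d2 i).
  apply: (near_eq_is_derive _ (h2 i)); near=> q.
  have dq : is_derive q (qbase R i) (coord_map h g x) (d1 i q) by near: q; exact: h1.
  by case: dq.
split=> [i|].
  split; last by case: (D i).
  by near=> q; have [] : is_derive q (qbase R i) (coord_map h g x) (d1 i q)
    by near: q; exact: h1.
by rewrite /laplacian -[RHS]h3; apply: eq_bigr => i _; case: (D i).
Unshelve. all: by end_near. Qed.

(** * Axially symmetric functions of a quaternion *)

Section Axial.
Variable R : realType.
Implicit Types (q x : quat R) (l : 'I_4).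
Local Notation q0 := Defs.q0.

Definition imnorm q := Num.sqrt (q 0 q1 ^+ 2 + q 0 q2 ^+ 2 + q 0 q3 ^+ 2).

Lemma imnorm_sqr q : imnorm q ^+ 2 = q 0 q1 ^+ 2 + q 0 q2 ^+ 2 + q 0 q3 ^+ 2.
Proof. by rewrite /imnorm sqr_sqrtr // !addr_ge0 // sqr_ge0. Qed.

Lemma continuous_quat_coord l : continuous (fun q => q 0 l).
Proof. by move=> q; exact: (@coord_continuous R 1 4 0 l q). Qed.

Lemma continuous_imnorm : continuous imnorm.
Proof.
move=> q; have c l : p 0 l ^+ 2 @[p --> q] --> q 0 l ^+ 2.
  exact: cvgM (@continuous_quat_coord l q) (@continuous_quat_coord l q).
have s : {for q 0 q1 ^+ 2 + q 0 q2 ^+ 2 + q 0 q3 ^+ 2, continuous (@Num.sqrt R)}.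
  exact: sqrt_continuous.
exact: continuous_cvg s (cvgD (cvgD (c q1) (c q2)) (c q3)).
Qed.

Lemma line_coord (h : R) l q m :
  (h *: qbase R l + q) 0 m = (if m == l then h else 0) + q 0 m.
Proof.
rewrite [LHS]mxE; congr (_ + _); rewrite [LHS]mxE /qbase mxE eqxx /=.
by case: (m == l); rewrite ?mulr1 ?mulr0.
Qed.

Lemma ord4P l : [\/ l = q0, l = q1, l = q2 | l = q3].
Proof.
case: l => -[|[|[|[|//]]]] p; [exact/Or41/val_inj|exact/Or42/val_inj|
  exact/Or43/val_inj|exact/Or44/val_inj].
Qed.

(** Along an imaginary direction the square of the norm of the imaginary part
    is r ^ 2 + 2 q_l h + h ^ 2. *)
Lemma der_imnorm q l : 0 < imnorm q -> l != q0 ->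
  is_derive (0 : R) 1 (fun h => imnorm (h *: qbase R l + q)) (q 0 l / imnorm q).
Proof.
move=> r0 ln0.
have E h : imnorm (h *: qbase R l + q) = Num.sqrt (imnorm q ^+ 2 + (2 * q 0 l * h + h ^+ 2)).
  rewrite imnorm_sqr /imnorm !line_coord; congr Num.sqrt.
  by case: (ord4P l) ln0 => -> //= _; ring.
under eq_fun do rewrite E.
have s0 : 0 < imnorm q ^+ 2 + (2 * q 0 l * 0 + 0 ^+ 2) by rewrite mulr0 expr0n !addr0 exprn_gt0.
have ds := @is_derive1_sqrt R _ s0.
have dg : is_derive (0 : R) 1 (fun h : R => imnorm q ^+ 2 + (2 * q 0 l * h + h ^+ 2)) (2 * q 0 l).
  by der; ring.
apply: (is_derive_eq (@der_comp R Num.sqrt _ 0 _ _ ds dg)).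
rewrite mulr0 expr0n !addr0 sqrtr_sqr gtr0_norm //.
by field; exact: lt0r_neq0.
Qed.

Lemma der_comp_imnorm (f : R -> R) q l (a : R) : 0 < imnorm q -> l != q0 ->
  is_derive (imnorm q) 1 f a -> is_derive (0 : R) 1
    (fun h => f (imnorm (h *: qbase R l + q))) (a * (q 0 l / imnorm q)).
Proof.
move=> r0 ln0 df; have dr := der_imnorm r0 ln0.
apply: (@der_comp R f (fun h => imnorm (h *: qbase R l + q)) 0 _ _ _ dr).
by rewrite scale0r add0r.
Qed.

Variables (v vx vy : R -> R -> R) (x : quat R) (e c : R).
Hypotheses (e0 : 0 < e) (x_nonreal : 0 < imnorm x).
Hypothesis dv : forall s t : R, `|s - x 0 q0| < e -> `|t - imnorm x| < e ->
  is_derive s 1 (v^~ t) (vx s t) /\ is_derive t 1 (v s) (vy s t).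
Hypothesis dvx : is_derive (x 0 q0) 1 (vx^~ (imnorm x)) c.
Hypothesis dvy : is_derive (imnorm x) 1 (vy (x 0 q0)) (- c).

(** With r the norm of the imaginary part, the second derivative of v / r in
    q_0 is v_xx / r, and the one in q_l for l <> 0 is
    v_y / r ^ 2 - v / r ^ 3 + (q_l ^ 2 / r) (v_yy / r ^ 2 - 3 v_y / r ^ 3 +
    3 v / r ^ 4).  As the q_l ^ 2 add up to r ^ 2, the sum is
    (v_xx + v_yy) / r. *)
Lemma axial_harmonic :
  harmonic4 (fun q => (imnorm q)^-1 * v (q 0 q0) (imnorm q)) x.
Proof.
pose d1 l q := if l == q0 then (imnorm q)^-1 * vx (q 0 q0) (imnorm q)
  else q 0 l * (vy (q 0 q0) (imnorm q) * (imnorm q)^-1 ^+ 2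
                - v (q 0 q0) (imnorm q) * (imnorm q)^-1 ^+ 2 * (imnorm q)^-1).
pose r := imnorm x; pose v0 := v (x 0 q0) r; pose a := vy (x 0 q0) r.
pose d2 l := if l == q0 then r^-1 * c
  else (a * r^-1 ^+ 2 - v0 * r^-1 ^+ 3) + x 0 l ^+ 2 * r^-1 *
    (- c * r^-1 ^+ 2 - 3 * a * r^-1 ^+ 3 + 3 * v0 * r^-1 ^+ 4).
have line0 (l : 'I_4) q : 0 *: qbase R l + q = q by rewrite scale0r add0r.
have lq0 (l : 'I_4) q (h : R) : l != q0 -> (h *: qbase R l + q) 0 q0 = q 0 q0.
  by rewrite line_coord eq_sym => /negbTE ->; rewrite add0r.
have q0E q (h : R) : (h *: qbase R q0 + q) 0 q0 = h + q 0 q0.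
  by rewrite line_coord eqxx.
have q0r q (h : R) : imnorm (h *: qbase R q0 + q) = imnorm q.
  by rewrite /imnorm !line_coord /= !add0r.
have dshift (f : R -> R) (s l : R) : is_derive s 1 f l ->
    is_derive (0 : R) 1 (fun h => f (h + s)) l.
  move=> df; rewrite -(add0r s) in df.
  apply: (is_derive_eq (@der_comp R f (fun h => h + s) 0 l 1 df _)); last by rewrite mulr1.
  by der; rewrite addr0.
have n1 (k : R) : 0 < k -> nbhs x (fun q : quat R => `|q 0 q0 - x 0 q0| < k).
  by move=> k0; have /cvgrPdistC_lt/(_ k k0) := @continuous_quat_coord q0 x.
have n2 (k : R) : 0 < k -> \forall q \near x, `|imnorm q - imnorm x| < k.
  by move=> k0; have /cvgrPdistC_lt/(_ k k0) := @continuous_imnorm x.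
exists d1, d2; split=> [l|l|].
- near=> q.
  have h1 : `|q 0 q0 - x 0 q0| < e by near: q; exact: n1.
  have h2 : `|imnorm q - imnorm x| < e by near: q; exact: n2.
  have rq : 0 < imnorm q.
    have : `|imnorm q - imnorm x| < imnorm x by near: q; exact: n2.
    by rewrite ltr_norml => /andP[+ _]; rewrite ltrBrDl subrr.
  have [D1 D2] := dv h1 h2.
  apply/(is_derive_lineP _ q (qbase R l) _).2.
  have [->|ln0] := eqVneq l q0.
    under eq_fun do rewrite q0E q0r.
    have Ds := dshift (v^~ (imnorm q)) _ _ D1.
    by rewrite /d1 eqxx; der; ring.
  under eq_fun do rewrite lq0 //.
  have dr := der_imnorm rq ln0; have dc := der_comp_imnorm rq ln0 D2.
  rewrite /d1 (negbTE ln0); der; rewrite line0; first exact: lt0r_neq0.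
  by ring.
- apply/(is_derive_lineP _ x (qbase R l) _).2; rewrite /d1 /d2.
  have h1 : `|x 0 q0 - x 0 q0| < e by rewrite subrr normr0.
  have h2 : `|imnorm x - imnorm x| < e by rewrite subrr normr0.
  have [D1 D2] := dv h1 h2.
  have [->|ln0] := eqVneq l q0.
    under eq_fun do rewrite q0E q0r.
    have Ds := dshift (vx^~ (imnorm x)) _ _ dvx.
    by der; ring.
  under eq_fun do rewrite lq0 //.
  have dr := der_imnorm x_nonreal ln0.
  have dc := der_comp_imnorm x_nonreal ln0 D2.
  have dc' := der_comp_imnorm x_nonreal ln0 dvy.
  have dl : is_derive (0 : R) 1 (fun h : R => (h *: qbase R l + x) 0 l) 1.
    by under eq_fun do rewrite line_coord eqxx; der; rewrite addr0.
  der; rewrite ?line0 //; try exact: lt0r_neq0.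
  by rewrite /a /v0 /r; ring.
- have E : r^-1 * (x 0 q1 ^+ 2 + x 0 q2 ^+ 2 + x 0 q3 ^+ 2) = r.
    by rewrite -imnorm_sqr expr2 mulKf //; exact: lt0r_neq0.
  have sum4 (f : 'I_4 -> R) : \sum_i f i = f q0 + f q1 + f q2 + f q3.
    rewrite !big_ord_recl big_ord0 addr0 !addrA.
    by congr (f _ + f _ + f _ + f _); exact: val_inj.
  rewrite sum4 /d2 /=.
  set k := - c * _ - _ + _; set m := a * _ - _.
  transitivity (r^-1 * c + 3 * m + (r^-1 * (x 0 q1 ^+ 2 + x 0 q2 ^+ 2 + x 0 q3 ^+ 2)) * k).
    ring.
  by rewrite E /k /m; field; exact: lt0r_neq0.
Unshelve. all: by end_near. Qed.

End Axial.

(** * The plane of one complex coordinate *)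

Section Plane.
Variables (R : realType) (n : nat).
Local Notation C := R[i].
Implicit Types (z : 'rV[C]_n) (h : 'I_n).

Definition plane h z (x y : R) : 'rV[C]_n := set_coord h z (x +i* y).

Lemma plane_h h z x y : plane h z x y 0 h = x +i* y.
Proof. by rewrite set_coordE eqxx. Qed.

Lemma plane_id h z : plane h z (complex.Re (z 0 h)) (complex.Im (z 0 h)) = z.
Proof.
rewrite /plane (_ : _ +i* _ = z 0 h) ?set_coord_id //.
by case: (z 0 h).
Qed.

Lemma set_coord_plane h z x y (t : C) : set_coord h (plane h z x y) t = set_coord h z t.
Proof. by apply/rowP => l; rewrite !set_coordE; case: eqP. Qed.

Lemma plane_conj h z x y : plane h z x (- y) = conj_coord h (plane h z x y).
Proof. by rewrite /conj_coord plane_h set_coord_plane. Qed.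

Lemma continuous_plane h z : continuous (fun p : R * R => plane h z p.1 p.2).
Proof.
move=> q; apply/cvg_ballP => e e0.
move: (e0); case: e e0 => er ei e0; rewrite ltcE /= => /andP[/eqP ei0 er0].
rewrite {}ei0 in e0 *.
have near_q : nbhs q (fun p : R * R => `|q.1 - p.1| < er / 2 /\ `|q.2 - p.2| < er / 2).
  by exists (ball q.1 (er / 2), ball q.2 (er / 2)); [split; apply: nbhsx_ballx; rewrite divr_gt0|case].
near=> p; have [p1 p2] : `|q.1 - p.1| < er / 2 /\ `|q.2 - p.2| < er / 2 by near: p.
split=> // i j; rewrite /plane !mxE; case: ifPn => _; last exact: ballxx.
rewrite /ball /= normc_def ltcR /=.
have sq (x y : R) : Num.sqrt (x ^+ 2 + y ^+ 2) <= `|x| + `|y|.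
  rewrite -[leRHS]ger0_norm ?addr_ge0 // -sqrtr_sqr ler_wsqrtr // sqrrD !real_normK ?num_real //.
  by rewrite lerD2r lerDl mulrn_wge0 // mulr_ge0.
by apply: le_lt_trans (sq _ _) _; rewrite (splitr er) ltrD.
Unshelve. all: by end_near. Qed.

Lemma near_plane h z (P : 'rV[C]_n -> Prop) x y : (\forall w \near plane h z x y, P w) ->
  exists2 e, 0 < e & forall x' y', `|x' - x| < e -> `|y' - y| < e -> P (plane h z x' y').
Proof.
move=> /(continuous_plane (x := (x, y))); rewrite -/(nbhs _ _) => /nbhs_ballP[e /= e0 eP].
by exists e => // x' y' hx hy; apply: (eP (x', y')); split; rewrite /ball /= distrC.
Qed.
End Plane.

(** * Derivatives of stem functions under conjugation *)

Lemma is_derive_quat_coord (R : realType) (g : R -> quat R) (x : R) (l : quat R) c :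
  is_derive x 1 g l -> is_derive x 1 (fun t => g t 0 c) (l 0 c).
Proof.
move=> [dg <-]; split.
  exact: ((@derivable_mxP R R^o 1 4 g x 1).1 dg 0 c).
by rewrite (@derive_mx R R^o 1 4 g x 1 dg) mxE.
Qed.

Section Stem.
Variables (R : realType) (n : nat) (D : set 'rV[R[i]]_n) (h : 'I_n).
Variable F : 'rV[R[i]]_n -> {ffun {set 'I_n} -> quat R}.
Hypotheses (openD : open D) (conjD : conj_invariant D) (sF : stem D F).
Hypothesis FC1 : classC1 D F.
Implicit Types (z : 'rV[R[i]]_n) (K : {set 'I_n}) (l : 'I_n).

Lemma stemE K l z : D z -> F (conj_coord l z) K = (-1) ^+ (l \in K) *: F z K.
Proof.
by move=> Dz; rewrite sF // card_setI1; case: (l \in K);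
  rewrite ?mulN1r ?scaleN1r ?mul1r ?scale1r.
Qed.

Lemma plane_conj_coord l z x y : l != h ->
  plane h (conj_coord l z) x y = conj_coord l (plane h z x y).
Proof.
move=> lh; apply/rowP => k; rewrite !set_coordE.
case: (eqVneq k h) => [->|kh]; first by rewrite eq_sym (negbTE lh).
by rewrite (negbTE lh).
Qed.

Lemma set_coord_idem (T : Type) (x : 'rV[T]_n) (s t : T) :
  set_coord h (set_coord h x s) t = set_coord h x t.
Proof. by apply/rowP => k; rewrite !set_coordE; case: eqP. Qed.

Lemma plane_open z : D z -> exists2 e, 0 < e &
  forall x y, `|x - complex.Re (z 0 h)| < e -> `|y - complex.Im (z 0 h)| < e ->
  D (plane h z x y).
Proof. by move=> Dz; apply: near_plane; rewrite plane_id; exact: open_nbhs_nbhs. Qed.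

Lemma near_alpha z : D z ->
  \forall t \near complex.Re (z 0 h), D (plane h z t (complex.Im (z 0 h))).
Proof.
move=> /plane_open[e e0 eD]; apply/nbhs_ballP; exists e => //= t te.
by apply: eD; rewrite ?subrr ?normr0 // distrC.
Qed.

Lemma near_beta z : D z ->
  \forall t \near complex.Im (z 0 h), D (plane h z (complex.Re (z 0 h)) t).
Proof.
move=> /plane_open[e e0 eD]; apply/nbhs_ballP; exists e => //= t te.
by apply: eD; rewrite ?subrr ?normr0 // distrC.
Qed.

Lemma near_betaN z : D z ->
  \forall t \near - complex.Im (z 0 h), D (plane h z (complex.Re (z 0 h)) (- t)).
Proof.
move=> /plane_open[e e0 eD]; apply/nbhs_ballP; exists e => //= t te.
by apply: eD; rewrite ?subrr ?normr0 // addrC.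
Qed.

Lemma der_alpha K z : D z ->
  is_derive (complex.Re (z 0 h)) 1 (alpha_line h F K z) (dalpha h F z K).
Proof. by move=> /(FC1 h K)[da _ _ _]; rewrite ffunE derive1E; exact: derivableP. Qed.

Lemma der_beta K z : D z ->
  is_derive (complex.Im (z 0 h)) 1 (beta_line h F K z) (dbeta h F z K).
Proof. by move=> /(FC1 h K)[_ db _ _]; rewrite ffunE derive1E; exact: derivableP. Qed.

Lemma conj_coord_other l z : l != h -> conj_coord l z 0 h = z 0 h.
Proof. by move=> lh; rewrite set_coordE eq_sym (negbTE lh). Qed.

Lemma conj_coord_same z : conj_coord h z 0 h = (z 0 h)^*.
Proof. by rewrite set_coordE eqxx. Qed.

(** Conjugation of z_h leaves alpha_h unchanged, so the derivative in alpha_h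
    inherits the parity of F_K in every coordinate. *)
Lemma dalpha_conj K l z : D z ->
  dalpha h F (conj_coord l z) K = (-1) ^+ (l \in K) *: dalpha h F z K.
Proof.
move=> Dz; have da := der_alpha K Dz.
have : is_derive (complex.Re (z 0 h)) 1 (alpha_line h F K (conj_coord l z))
    ((-1) ^+ (l \in K) *: dalpha h F z K).
  apply: (near_eq_is_derive _ (is_deriveZ _ da)); near=> t.
  have Dt : D (plane h z t (complex.Im (z 0 h))) by near: t; exact: near_alpha.
  rewrite /= -[LHS]/(_ *: F (plane h z t (complex.Im (z 0 h))) K) -stemE //.
  have [->|lh] := eqVneq l h; rewrite /alpha_line.
    by rewrite conj_coord_same -plane_conj /conj_coord set_coord_idem; case: (z 0 h).
  by rewrite -/(plane _ _ _ _) plane_conj_coord // conj_coord_other.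
have -> : complex.Re (z 0 h) = complex.Re (conj_coord l z 0 h).
  have [->|lh] := eqVneq l h; last by rewrite conj_coord_other.
  by rewrite conj_coord_same; case: (z 0 h).
by case=> _ e; rewrite ffunE derive1E e.
Unshelve. all: by end_near. Qed.

(** Conjugation of z_h changes the sign of beta_h, so the derivative in beta_h
    has the opposite parity in the h-th coordinate. *)
Lemma dbeta_conj K l z : D z ->
  dbeta h F (conj_coord l z) K = (-1) ^+ ((l \in K) (+) (l == h)) *: dbeta h F z K.
Proof.
move=> Dz; have db := der_beta K Dz.
have [->|lh] := eqVneq l h; last first.
  have : is_derive (complex.Im (z 0 h)) 1 (beta_line h F K (conj_coord l z))
      ((-1) ^+ (l \in K) *: dbeta h F z K).
    apply: (near_eq_is_derive _ (is_deriveZ _ db)); near=> t.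
    have Dt : D (plane h z (complex.Re (z 0 h)) t) by near: t; exact: near_beta.
    rewrite /= -[LHS]/(_ *: F (plane h z (complex.Re (z 0 h)) t) K) -stemE //.
    by rewrite /beta_line -/(plane _ _ _ _) plane_conj_coord // conj_coord_other.
  by case=> _ e; rewrite ffunE derive1E conj_coord_other // e addbF.
have : is_derive (- complex.Im (z 0 h)) 1 (beta_line h F K (conj_coord h z))
    ((-1) ^+ (h \in K) *: - dbeta h F z K).
  apply: (near_eq_is_derive _ (is_deriveZ _ (is_derive_oppo db))); near=> t.
  have Dt : D (plane h z (complex.Re (z 0 h)) (- t)).
    by near: t; exact: near_betaN.
  rewrite /= -[LHS]/(_ *: F (plane h z (complex.Re (z 0 h)) (- t)) K) -stemE //.
  by rewrite -plane_conj opprK /beta_line conj_coord_same /conj_coord set_coord_idem; case: (z 0 h).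
case=> _ e; rewrite ffunE derive1E conj_coord_same.
rewrite (_ : complex.Im _ = - complex.Im (z 0 h)); last by case: (z 0 h).
by rewrite e addbT; case: (h \in K); rewrite ?scaleN1r ?scale1r ?opprK.
Unshelve. all: by end_near. Qed.

End Stem.

(** * Slice functions and the Cauchy-Riemann equations *)

Section Slice.
Variables (R : realType) (n : nat) (D : set 'rV[R[i]]_n) (h : 'I_n).
Implicit Types (F G : 'rV[R[i]]_n -> {ffun {set 'I_n} -> quat R}).
Implicit Types (z : 'rV[R[i]]_n) (K : {set 'I_n}) (l : 'I_n).

Lemma eq_slice_fun F G x : (forall z, D z -> F z = G z) ->
  circularization D x -> slice_fun D F x = slice_fun D G x.
Proof.
move=> FG [z Dz [J uJ xE]]; rewrite /slice_fun; case: xgetP => [zJ _ /= []|].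
  by move=> Dz' _ _; rewrite /slice_value FG.
by move=> /(_ (z, J)) /=; case.
Qed.

Lemma eq_dbar_stem F G z : open D -> (forall z, D z -> F z = G z) -> D z ->
  dbar_stem h F z = dbar_stem h G z.
Proof.
move=> oD FG Dz; have ea : dalpha h F z = dalpha h G z.
  apply/ffunP => K; rewrite !ffunE !derive1E; apply: near_eq_derive; near=> t.
  by rewrite /alpha_line FG //; near: t; exact: near_alpha.
have eb : dbeta h F z = dbeta h G z.
  apply/ffunP => K; rewrite !ffunE !derive1E; apply: near_eq_derive; near=> t.
  by rewrite /beta_line FG //; near: t; exact: near_beta.
by rewrite /dbar_stem ea eb.
Unshelve. all: by end_near. Qed.

Lemma stem_spherical F : stem D F -> stem (D `\` real_coordC h) (spherical_stem h F).
Proof.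
move=> sF K l z [Dz _]; rewrite !spherical_stemE card_setI1.
case: ifPn => hK; first by rewrite mulr0.
rewrite (stemE sF) //; have [->|lh] := eqVneq l h.
  rewrite conj_coord_same (negbTE hK) expr0 mul1r !inE eqxx /= expr1 scaleN1r.
  by case: (z 0 h) => a b /=; rewrite invrN scaleNr scalerN opprK.
rewrite conj_coord_other // !inE (negbTE lh) /=.
by case: (l \in K); rewrite ?mulN1r ?mul1r ?scaleN1r ?scale1r ?scalerN.
Qed.

Lemma conj_invariant_nonreal : conj_invariant D -> conj_invariant (D `\` real_coordC h).
Proof.
move=> cD l z; have E : real_coordC h (conj_coord l z) <-> real_coordC h z.
  rewrite /real_coordC /=; have [->|lh] := eqVneq l h; last by rewrite conj_coord_other.
  rewrite conj_coord_same; case: (z 0 h) => a b /=.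
  by split=> [/eqP|->]; rewrite ?oppr0 // oppr_eq0 => /eqP.
by split=> -[/(cD l z) Dz zr]; split=> // /E.
Qed.

(** J_h moves the component of K by adding or removing h, which restores the
    parity that the derivative in beta_h had changed. *)
Lemma opJ_sign l (b b' : {ffun {set 'I_n} -> quat R}) K :
  (forall L, b' L = (-1) ^+ ((l \in L) (+) (l == h)) *: b L) ->
  opJ h b' K = (-1) ^+ (l \in K) *: opJ h b K.
Proof.
move=> eb; rewrite !opJE; case: (boolP (h \in K)) => hK; rewrite eb !inE.
  have [->|lh] := eqVneq l h; first by rewrite hK.
  by rewrite addbF.
have [->|lh] := eqVneq l h; first by rewrite (negbTE hK) scalerN.
by rewrite addbF scalerN.
Qed.

Variable F : 'rV[R[i]]_n -> {ffun {set 'I_n} -> quat R}.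
Hypotheses (openD : open D) (conjD : conj_invariant D) (sF : stem D F).
Hypothesis FC1 : classC1 D F.

Lemma stem_dbar : stem D (dbar_stem h F).
Proof.
move=> K l z Dz; rewrite card_setI1.
have sgn (b : bool) (q : quat R) : (-1) ^+ b * q = (-1 : R) ^+ b *: q.
  by case: b; rewrite ?mulN1r ?scaleN1r ?mul1r ?scale1r.
have E w L : dbar_stem h F w L = 2^-1 *: (dalpha h F w L + opJ h (dbeta h F w) L).
  by rewrite /dbar_stem ffunE [in LHS]ffunE.
have ea L := dalpha_conj h openD sF FC1 L l Dz.
have eb L := dbeta_conj h openD sF FC1 L l Dz.
have sumE (s t : R) (a a' b b' : quat R) : a' = s *: a -> b' = s *: b ->
    t *: (a' + b') = s *: (t *: (a + b)).
  by move=> -> ->; rewrite -scalerDr !scalerA mulrC.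
rewrite sgn; apply: etrans (E _ K) _.
apply: etrans (sumE _ _ _ _ _ _ (ea K) (opJ_sign K eb)) _.
exact: congr1 (esym (E z K)).
Qed.

(** A stem function is determined by the slice function that it induces, here
    the zero function. *)
Lemma dbar_stem_eq0 z : D z ->
  (forall x, circularization D x -> slice_fun D (dbar_stem h F) x = 0) ->
  dbar_stem h F z = 0.
Proof.
move=> Dz F0; apply: (@induces_inj R n D (dbar_stem h F) (fun=> 0) (fun=> 0)) => //.
  by split=> [|x Dx]; [exact: stem_dbar|rewrite F0].
split=> [K l w _|x _]; first by rewrite !ffunE mulr0.
by rewrite /slice_fun /slice_value big1 // => K _; rewrite ffunE mulr0.
Qed.

Hypothesis F_ker : forall z, D z -> dbar_stem h F z = 0.

(** F_K + i F_(K u h) is holomorphic in z_h. *)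
Lemma cauchy_riemann_stem K z : D z -> h \notin K ->
  dalpha h F z K = dbeta h F z (h |: K) /\
  dalpha h F z (h |: K) = - dbeta h F z K.
Proof.
move=> Dz hK; have E L : dalpha h F z L + opJ h (dbeta h F z) L = 0.
  have /ffunP/(_ L) := F_ker Dz; rewrite /dbar_stem !ffunE => /eqP.
  by rewrite scaler_eq0 invr_eq0 pnatr_eq0 /= => /eqP.
have := E K; rewrite opJE (negbTE hK) => /eqP; rewrite subr_eq0 => /eqP ->.
have := E (h |: K); rewrite opJE !inE eqxx /= finset.setU1K // => /eqP.
by rewrite addr_eq0 => /eqP ->.
Qed.

Lemma der_plane_alpha z K c x y : D (plane h z x y) ->
  is_derive x 1 (fun t => F (plane h z t y) K 0 c) (dalpha h F (plane h z x y) K 0 c).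
Proof.
move=> Dxy; have := is_derive_quat_coord c (der_alpha h FC1 K Dxy).
rewrite plane_h /= /alpha_line; under eq_fun do rewrite plane_h set_coord_plane.
by [].
Qed.

Lemma der_plane_beta z K c x y : D (plane h z x y) ->
  is_derive y 1 (fun t => F (plane h z x t) K 0 c) (dbeta h F (plane h z x y) K 0 c).
Proof.
move=> Dxy; have := is_derive_quat_coord c (der_beta h FC1 K Dxy).
rewrite plane_h /= /beta_line; under eq_fun do rewrite plane_h set_coord_plane.
by [].
Qed.

Lemma continuous_dalpha_plane z K c (x y : R) : D (plane h z x y) ->
  {for (x, y), continuous (fun p : R * R => dalpha h F (plane h z p.1 p.2) K 0 c)}.
Proof.
move=> Dxy; have [_ _ ca _] := FC1 h K Dxy.
have c1 := continuous_cvg _ ca (@continuous_plane _ _ h z (x, y)).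
have c2 : {for dalpha h F (plane h z x y) K, continuous (fun q : quat R => q 0 c)}.
  exact: continuous_quat_coord.
exact: continuous_cvg c2 (c1 _).
Qed.

Lemma stem_coef_harmonic z K c : D z -> h \notin K -> exists e k, [/\ 0 < e,
  forall s t : R, `|s - complex.Re (z 0 h)| < e -> `|t - complex.Im (z 0 h)| < e ->
    is_derive s 1 (fun s => F (plane h z s t) (h |: K) 0 c)
      (dalpha h F (plane h z s t) (h |: K) 0 c) /\
    is_derive t 1 (fun t => F (plane h z s t) (h |: K) 0 c)
      (dbeta h F (plane h z s t) (h |: K) 0 c),
  is_derive (complex.Re (z 0 h)) 1
    (fun s => dalpha h F (plane h z s (complex.Im (z 0 h))) (h |: K) 0 c) k &
  is_derive (complex.Im (z 0 h)) 1
    (fun t => dbeta h F (plane h z (complex.Re (z 0 h)) t) (h |: K) 0 c) (- k)].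
Proof.
move=> Dz hK; have [e e0 eD] := plane_open h openD Dz.
have oppE (q : quat R) : (- q) 0 c = - q 0 c by exact: mxE.
pose a s t := dalpha h F (plane h z s t) K 0 c.
pose b s t := dalpha h F (plane h z s t) (h |: K) 0 c.
have aE s t : `|s - complex.Re (z 0 h)| < e -> `|t - complex.Im (z 0 h)| < e ->
    a s t = dbeta h F (plane h z s t) (h |: K) 0 c.
  by move=> hs ht; rewrite /a; have [-> _] := cauchy_riemann_stem (eD _ _ hs ht) hK.
have bE s t : `|s - complex.Re (z 0 h)| < e -> `|t - complex.Im (z 0 h)| < e ->
    - b s t = dbeta h F (plane h z s t) K 0 c.
  move=> hs ht; rewrite /b; have [_ ->] := cauchy_riemann_stem (eD _ _ hs ht) hK.
  by rewrite oppE opprK.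
have [|s t hs ht|s t hs ht|s t hs ht|s t hs ht|k [kb ka]] := @cauchy_riemann_harmonic R
  (fun s t => F (plane h z s t) K 0 c) (fun s t => F (plane h z s t) (h |: K) 0 c)
  a b (complex.Re (z 0 h)) (complex.Im (z 0 h)) e.
- exact: e0.
- by rewrite bE //; split; [apply: der_plane_alpha|apply: der_plane_beta]; exact: eD.
- by rewrite aE //; split; [apply: der_plane_alpha|apply: der_plane_beta]; exact: eD.
- by apply: continuous_dalpha_plane; exact: eD.
- by apply: continuous_dalpha_plane; exact: eD.
exists e, k; split=> // [s t hs ht|].
  by split; [apply: der_plane_alpha|apply: der_plane_beta]; exact: eD.
apply: (near_eq_is_derive _ ka); apply/nbhs_ballP; exists e => //= t te.
by rewrite aE // ?subrr ?normr0 // distrC.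
Qed.

End Slice.

(** * Polar form of a quaternion and the spherical derivative *)

Section Coordinates.
Variable R : realType.
Implicit Types q a : quat R.

Lemma imunit_coord a : a 0 q0 = 0 ->
  a 0 q1 ^+ 2 + a 0 q2 ^+ 2 + a 0 q3 ^+ 2 = 1 -> imunit a.
Proof.
move=> a0 a1; have [e0 e1 e2 e3] := mulqE a a; have [o0 o1 o2 o3] := oneqE R.
have oppE (b : quat R) l : (- b) 0 l = - b 0 l by exact: mxE.
rewrite /imunit /= expr2; apply: quatP; rewrite !oppE o0 o1 o2 o3 oppr0.
split; [rewrite -a1 [LHS]e0|rewrite [LHS]e1|rewrite [LHS]e2|rewrite [LHS]e3]; rewrite a0; ring.
Qed.

(** The imaginary unit I such that q = q_0 + r I, when q is not real. *)
Definition imdir q : quat R := (imnorm q)^-1 *: (q - (q 0 q0)%:A).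

Lemma imdirE q : [/\ imdir q 0 q0 = 0, imdir q 0 q1 = (imnorm q)^-1 * q 0 q1,
  imdir q 0 q2 = (imnorm q)^-1 * q 0 q2 & imdir q 0 q3 = (imnorm q)^-1 * q 0 q3].
Proof.
have E l : imdir q 0 l = (imnorm q)^-1 * (q 0 l - q 0 q0 * Defs.oneq R 0 l).
  rewrite [LHS]mxE; congr (_ * _); rewrite [LHS]mxE; congr (_ + _).
  by rewrite [LHS]mxE; congr (- _); rewrite [LHS]mxE.
have [o0 o1 o2 o3] := oneqE R.
by split; rewrite E ?o0 ?o1 ?o2 ?o3 ?mulr1 ?mulr0 ?subr0 // subrr mulr0.
Qed.

Lemma imunit_imdir q : 0 < imnorm q -> imunit (imdir q).
Proof.
move=> r0; have [e0 e1 e2 e3] := imdirE q; apply: imunit_coord => //.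
rewrite e1 e2 e3 !exprMn -!mulrDr -imnorm_sqr -exprMn mulVf ?expr1n //.
exact: lt0r_neq0.
Qed.

Lemma quat_polar q : 0 < imnorm q -> q = (q 0 q0)%:A + imnorm q *: imdir q.
Proof. by move=> r0; rewrite scalerA mulfV ?lt0r_neq0 // scale1r addrC subrK. Qed.

Lemma quat_mul_coord (a q : quat R) : a * q = \sum_(l < 4) q 0 l *: (a * qbase R l).
Proof.
rewrite {1}(matrix_sum_delta q) big_ord1 mulr_sumr.
by apply: eq_bigr => l _; rewrite -scalerAr.
Qed.

End Coordinates.

Section SphericalDerivative.
Variables (R : realType) (n : nat) (D : set 'rV[R[i]]_n) (h : 'I_n).
Implicit Types (z : 'rV[R[i]]_n) (J : 'rV[quat R]_n).

Lemma imnorm_qpoint z J : imunits J -> imnorm (qpoint z J 0 h) = `|complex.Im (z 0 h)|.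
Proof.
move=> uJ; have [_ j1] := imunitP (uJ h); have [_ e1 e2 e3] := qpoint_coord z h uJ.
by rewrite /imnorm e1 e2 e3 !exprMn -!mulrDr j1 mulr1 sqrtr_sqr.
Qed.

Lemma set_coord_qpoint z J q : 0 < imnorm q ->
  set_coord h (qpoint z J) q =
  qpoint (plane h z (q 0 q0) (imnorm q)) (set_coord h J (imdir q)).
Proof.
move=> r0; apply/rowP => l; rewrite [RHS]mxE !set_coordE.
by case: eqP => _ /=; [exact: quat_polar|rewrite mxE].
Qed.

Lemma imunits_set_coord J q : imunits J -> imunit q -> imunits (set_coord h J q).
Proof. by move=> uJ uq l; rewrite set_coordE; case: eqP. Qed.

(** Conjugating z_h and changing the sign of J_h does not change the point, so
    beta_h can be taken positive. *)
Lemma qpoint_positive x : conj_invariant D ->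
  circularization (D `\` real_coordC h) x ->
  exists z J, [/\ D z, imunits J, 0 < complex.Im (z 0 h) & x = qpoint z J].
Proof.
move=> cD [z [Dz zh] [J uJ <-]]; have [zp|zn|z0] := ltgtP 0 (complex.Im (z 0 h)).
- by exists z, J.
- exists (conj_coord h z), (set_coord h J (- J 0 h)); split.
  + exact: (cD h z).1 Dz.
  + by apply: imunits_set_coord => //; apply: imunitN; exact: uJ.
  + by rewrite conj_coord_same; move: zn; case: (z 0 h) => a b /=; rewrite oppr_gt0.
  + apply/rowP => l; rewrite !mxE; case: eqP => [->|] //.
    by case: (z 0 h) => a b /=; rewrite scaleNr scalerN opprK.
- by case: zh; rewrite /real_coordC /= -z0.
Qed.

Variable F : 'rV[R[i]]_n -> {ffun {set 'I_n} -> quat R}.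
Hypotheses (openD : open D) (conjD : conj_invariant D) (sF : stem D F).

(** The h-th coordinate of x enters J_K F_(K u h) / r only through z, because
    h is not in K.  The values are expanded in the basis of the quaternions, so
    that each term is a real function times a constant quaternion. *)
Lemma slice_spherical z J (q : quat R) : D (plane h z (q 0 q0) (imnorm q)) -> imunits J ->
  0 < imnorm q ->
  slice_fun (D `\` real_coordC h) (spherical_stem h F) (set_coord h (qpoint z J) q) =
  \sum_(K : {set 'I_n} | h \notin K) \sum_(l < 4)
    ((imnorm q)^-1 * F (plane h z (q 0 q0) (imnorm q)) (h |: K) 0 l) *:
      (qprod K J * qbase R l).
Proof.
move=> Dq uJ r0; rewrite set_coord_qpoint // slice_funE.
- rewrite /slice_value [RHS]big_mkcond /=; apply: eq_bigr => K _.
  rewrite spherical_stemE; case: ifPn => hK /=; first by rewrite mulr0.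
  rewrite plane_h /= quat_mul_coord; apply: eq_bigr => l _.
  congr (_ *: (_ * _)); first exact: mxE.
  apply: eq_bigr => k kK; rewrite set_coordE; case: eqP => // kh.
  by rewrite -kh kK in hK.
- exact: conj_invariant_nonreal.
- exact: stem_spherical.
- by split=> //; rewrite /real_coordC /= plane_h /=; apply/eqP/lt0r_neq0.
- by apply: imunits_set_coord => //; exact: imunit_imdir.
Qed.

End SphericalDerivative.

Theorem proposition4p9 (R : realType) (n : nat) (D : set 'rV[R[i]]_n)
    (f : 'rV[quat R]_n -> quat R) (h : 'I_n)
    (openD : open D) (conjD : conj_invariant D) (fC1 : sliceC1 D f)
    (f_ker : forall x, circularization D x -> slice_dbar D h f x = 0) :
  forall x, (circularization D `\` real_coordH h) x ->
    laplacian_defined h (spherical_deriv D h f) x /\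
    laplacian h (spherical_deriv D h f) x = 0.
Proof.
move=> x; rewrite -circularization_real => Dx; apply: harmonic4_laplacian.
have [z [J [Dz uJ zh xE]]] := qpoint_positive conjD Dx.
have [F [Ff FC1]] := fC1; have sF := Ff.1.
(* Only the values of the stem function on the open set D matter, so the one
   that induces f can be taken of class C^1. *)
have GF w : D w -> stem_of D f w = F w.
  move=> Dw; apply: (induces_inj conjD _ Ff Dw).
  by rewrite /stem_of; case: xgetP => [G _ //|/(_ F)].
have F_ker w : D w -> dbar_stem h F w = 0.
  move=> Dw; apply: (dbar_stem_eq0 openD conjD sF FC1 Dw) => y Dy.
  have FG u : D u -> dbar_stem h F u = dbar_stem h (stem_of D f) u.
    by move=> Du; apply: (eq_dbar_stem h openD _ Du) => s Ds; rewrite GF.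
  exact: etrans (eq_slice_fun FG Dy) (f_ker y Dy).
have [e0 _ _ _] := qpoint_coord z h uJ.
have rE : imnorm (x 0 h) = complex.Im (z 0 h).
  by rewrite xE imnorm_qpoint // gtr0_norm.
have r0 : 0 < imnorm (x 0 h) by rewrite rE.
rewrite -xE in e0.
have [e e_gt0 eD] := plane_open h openD Dz.
(* The expression of the spherical derivative near the h-th coordinate of x. *)
pose g (q : quat R) := \sum_(K : {set 'I_n} | h \notin K) \sum_(l < 4)
    ((imnorm q)^-1 * F (plane h z (q 0 q0) (imnorm q)) (h |: K) 0 l) *:
      (qprod K J * qbase R l).
apply: (@harmonic4_near _ _ g).
  have n1 (k : R) : 0 < k -> nbhs (x 0 h) (fun q : quat R => `|q 0 q0 - x 0 h 0 q0| < k).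
    by move=> k0; have /cvgrPdistC_lt/(_ k k0) := @continuous_quat_coord R q0 (x 0 h).
  have n2 (k : R) : 0 < k -> nbhs (x 0 h) (fun q : quat R => `|imnorm q - imnorm (x 0 h)| < k).
    by move=> k0; have /cvgrPdistC_lt/(_ k k0) := @continuous_imnorm R (x 0 h).
  near=> q.
  have Dq : D (plane h z (q 0 q0) (imnorm q)).
    by apply: eD; [rewrite -e0; near: q; exact: n1|rewrite -rE; near: q; exact: n2].
  have rq : 0 < imnorm q.
    have : `|imnorm q - imnorm (x 0 h)| < imnorm (x 0 h) by near: q; exact: n2.
    by rewrite ltr_norml => /andP[+ _]; rewrite ltrBrDl subrr.
  rewrite /g /coord_map /spherical_deriv xE -(slice_spherical conjD sF Dq uJ rq).
  apply: eq_slice_fun.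
    move=> w [Dw _]; apply/ffunP => K; rewrite !spherical_stemE.
    by case: ifP => // _; rewrite GF.
  exists (plane h z (q 0 q0) (imnorm q)).
    by split=> //; rewrite /real_coordC /= plane_h /=; apply/eqP/lt0r_neq0.
  exists (set_coord h J (imdir q)); last by rewrite set_coord_qpoint.
  by apply: imunits_set_coord => //; exact: imunit_imdir.
apply: harmonic4_sum => K hK; apply: harmonic4_sum => l _; apply: harmonic4_scalel.
have [d [k [d0 dv dvx dvy]]] := stem_coef_harmonic openD FC1 F_ker l Dz hK.
rewrite -e0 -rE in dv dvx dvy.
exact: (@axial_harmonic R (fun s t => F (plane h z s t) (h |: K) 0 l)
  (fun s t => dalpha h F (plane h z s t) (h |: K) 0 l)
  (fun s t => dbeta h F (plane h z s t) (h |: K) 0 l) (x 0 h) d k d0 r0 dv dvx dvy).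
Unshelve. all: by end_near. Qed.
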